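(* Let $R$ be an affine domain of characteristic zero with finite quotients, let $n$ be a positive integer, and let $f \in R[x_1,\dots,x_n]^n$. Then the following assertions are equivalent: (i) $f \colon R^n \to R^n$ is surjective. (ii) $f \colon R^n \to R^n$ is invertible. (iii) $\det(Jf) \in R^\times$ and the induced map $f \colon (R/\mathfrak{m})^n \to (R/\mathfrak{m})^n$ is bijective for every maximal ideal $\mathfrak{m} \subseteq R$.
   Context: All rings are commutative with unity. A domain $R$ is called affine if it is either finitely generated as a ring (i.e. as a $\mathbb{Z}$-algebra) or finitely generated as an algebra over a subfield. An affine domain $R$ has finite quotients if $R/\mathfrak{m}$ is finite for every maximal ideal $\mathfrak{m} \subseteq R$. For $f = (f_1,\dots,f_n) \in R[x]^n$, $x=(x_1,\dots,x_n)$, and an $R$-algebra $S$, the polynomial map $f \colon S^n \to S^n$ is $a \mapsto (f_1(a),\dots,f_n(a))$. The map $f \colon R^n\to R^n$ is called invertible if $R[f_1,\dots,f_n] = R[x]$, equivalently if there exists $g \in R[x]^n$ with $f(g(x)) = g(f(x)) = x$. $Jf = (\partial f_i/\partial x_j)_{i,j}$ is the Jacobian matrix of $f$; the condition $\det(Jf)\in R^\times$ means that the polynomial $\det(Jf)$ is a constant which is a unit of $R$. *)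

(* Defs.v *)
From HB Require Import structures.
From mathcomp Require Import all_boot all_order all_algebra.
From mathcomp Require Import mpoly.

Set Implicit Arguments.
Unset Strict Implicit.
Unset Printing Implicit Defensive.

Import GRing.Theory.
Local Open Scope ring_scope.

(* [mmap intr (tnth a)] evaluates an integer polynomial at [a]: its values are
   the elements of the subring Z[a_1, ..., a_k]. *)
Definition fg_ring (R : idomainType) : Prop :=
  exists (k : nat) (a : k.-tuple R),
    forall x : R, exists p : {mpoly int[k]}, mmap intr (tnth a) p = x.

(* The clause [x \is a GRing.unit] is needed: [x^-1 = x] on non-units, so
   closure under [_^-1] alone would not exclude the subring Z of Z. *)
Definition is_subfield (R : idomainType) (K : {pred R}) : Prop :=
  subring_closed K /\
  (forall x : R, x \in K -> x != 0 -> x \is a GRing.unit /\ x^-1 \in K).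

Definition fg_algebra_over (R : idomainType) (K : {pred R}) : Prop :=
  exists (k : nat) (a : k.-tuple R),
    forall x : R,
    exists p : {mpoly R[k]}, p \is a mpolyOver k K /\ p.@[tnth a] = x.

Definition affine_domain (R : idomainType) : Prop :=
  fg_ring R \/
  exists K : {pred R}, is_subfield K /\ fg_algebra_over K.

(* Elements of [idealr R] are proper ideals (1 is excluded) given by boolean
   predicates; under excluded middle these are all the proper ideals of R. *)
Definition maximal_ideal (R : idomainType) (m : idealr R) : Prop :=
  forall J : idealr R, {subset m <= J} -> J =i m.

Definition finite_quotients (R : idomainType) : Prop :=
  forall m : idealr R, maximal_ideal m ->
    exists s : seq {ideal_quot m}, forall x : {ideal_quot m}, x \in s.

(* The map S^n -> S^n induced by f, for S an R-algebra with structure map phi. *)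
Definition poly_map (R S : comNzRingType) (phi : {rmorphism R -> S}) (n : nat)
    (f : n.-tuple {mpoly R[n]}) (a : n.-tuple S) : n.-tuple S :=
  [tuple mmap phi (tnth a) (tnth f i) | i < n].

(* R[f_1, ..., f_n] = R[x]: every polynomial p is of the form q(f_1, ..., f_n). *)
Definition invertible_map (R : comNzRingType) (n : nat)
    (f : n.-tuple {mpoly R[n]}) : Prop :=
  forall p : {mpoly R[n]}, exists q : {mpoly R[n]}, q \mPo f = p.

Definition jacobian (R : comNzRingType) (n : nat)
    (f : n.-tuple {mpoly R[n]}) : 'M[{mpoly R[n]}]_n :=
  \matrix_(i < n, j < n) (tnth f i)^`M(j).

(* Main.v *)
Require Import Defs.
From HB Require Import structures.
From mathcomp Require Import all_boot all_order all_algebra.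
From mathcomp Require Import mpoly.
From mathcomp Require Import boolp classical_sets.
From mathcomp Require Import mxpoly separable fieldext ring.

Set Implicit Arguments.
Unset Strict Implicit.
Unset Printing Implicit Defensive.
Import GRing.Theory.
Local Open Scope ring_scope.

(** Why the theorem is true.

    Finite quotients rule out a subfield of characteristic zero: all nonzero
    integers would be units, yet every maximal ideal contains a positive integer.
    Hence R is a finitely generated ring ([affine_fg_ring]).  For such a ring
    everything can be tested over prime fields: finitely many elements of a
    field of characteristic zero have a simultaneous ring-theoretic
    specialization to some F_p ([place_to_prime_field], [fg_place]).  Since the
    elements may be taken in any extension of Frac R, roots of polynomials over R
    and inverses of nonzero elements can be specialized too.  All of it
    lands in the prime field itself, which is what makes a hypothesis on R/m, with
    no extension of R/m, sufficient.

    (iii) => (ii).  If f is injective on every F_p^n reached by a map R -> F_p,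
    then f is injective on L^n for every field L over R ([point_injective]),
    because two points with the same image could be specialized to distinct
    points of F_p^n.  Apply this to the generic point x in Frac(R[x])^n: were x not
    rational over the field of fractions of R[f], moving a generator of
    Frac(R[x]) over an intermediate field, to a conjugate or to a translate, would
    give a second point over f(x).  So x_i = P_i(f)/Q_i(f) ([birational]).
    As det Jf is a unit, Newton iteration solves f(g) = b(t) modulo any power of t
    along the line b(t) joining f(0) to the generic point z ([newton]).  Then
    Q_i(b) g_i = P_i(b) modulo t^N.  The fraction P_i(b)/Q_i(b) has no pole: a pole
    would specialize to some t0 in F_p, surjectivity of f on F_p^n gives a point
    over b(t0), and the Newton solution through that point contradicts the pole
    ([no_pole]).  So g_i agrees with a polynomial in t of degree bounded
    independently of N, and for N large this polynomial solves f(g) = b(t)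
    exactly; at t = 1 it gives G with f(G(z)) = z ([polynomial_right_inverse]).
    Injectivity at the generic point turns G into a two-sided inverse.

    (ii) => (i).  If G(f(x)) = x, then f and G are inverse bijections on each
    finite set F_p^n, so f(G(x)) - x vanishes under all specializations to prime
    fields, hence vanishes ([invertible_two_sided]).

    (i) => (iii).  A surjective f is surjective, hence bijective, modulo every
    ideal of finite index.  If det Jf(a) were in a maximal ideal m, moving a by
    eps v, with v in the kernel of Jf(a) modulo m and eps in m but not in m^2,
    would not change f(a) modulo m^2, contradicting bijectivity on the finite ring
    R/m^2 ([jacobian_notin_maximal]).  So det Jf has no zero in any F_p^n, hence
    is constant because a nonconstant polynomial acquires a root under some
    specialization, and this constant lies in no maximal ideal
    ([jacobian_unit]). *)

(** * Evaluation of multivariate polynomials *)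

Lemma mpoly_ring_ind (R : comNzRingType) n (P : {mpoly R[n]} -> Prop) :
  (forall c, P c%:MP) -> (forall i, P 'X_i) ->
  (forall p q, P p -> P q -> P (p + q)) ->
  (forall p q, P p -> P q -> P (p * q)) -> forall p, P p.
Proof.
move=> PC PX PD PM p; elim/mpolyind: p => [|c m p _ _ Pp]; first by rewrite -mpolyC0.
apply: PD => //; rewrite -mul_mpolyC; apply: (PM) => //.
rewrite mpolyXE_id; apply: big_ind => [|x y|i _]; [by rewrite -mpolyC1 | exact: PM |].
by elim: (m i) => [|k IH]; rewrite ?expr0 ?exprS -?mpolyC1 //; apply: PM.
Qed.

Section Mmap.
Variables (R S : comNzRingType) (phi : {rmorphism R -> S}) (n : nat).
Implicit Types (a : 'I_n -> S) (p : {mpoly R[n]}).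

Lemma mmapXi a i : mmap phi a 'X_i = a i.
Proof. by rewrite mmapX mmap1U. Qed.

Lemma mmap_ext (psi : R -> S) a b p : phi =1 psi -> a =1 b -> mmap phi a p = mmap psi b p.
Proof.
move=> e1 e2; rewrite /mmap; apply: eq_bigr => m _; rewrite e1; congr (_ * _).
exact: mmap1_eq.
Qed.

Lemma mmap_eq a b p : a =1 b -> mmap phi a p = mmap phi b p.
Proof. exact: mmap_ext. Qed.

Lemma rmorph_mmap (T : comNzRingType) (h : {rmorphism S -> T}) a p :
  h (mmap phi a p) = mmap (h \o phi) (h \o a) p.
Proof.
rewrite /mmap rmorph_sum; apply: eq_bigr => m _; rewrite rmorphM; congr (_ * _).
by rewrite /mmap1 rmorph_prod; apply: eq_bigr => i _; rewrite rmorphXn.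
Qed.

End Mmap.

Lemma mmap_mmap (R S : comNzRingType) (phi : {rmorphism R -> S}) n k
    (q : 'I_k -> {mpoly R[n]}) a (p : {mpoly R[k]}) :
  mmap phi a (mmap (@mpolyC n R) q p) = mmap phi (fun i => mmap phi a (q i)) p.
Proof.
rewrite (rmorph_mmap _ (mmap phi a)); apply: mmap_ext => // x /=.
by rewrite mmapC.
Qed.


Lemma mmap_mpolyC_id (R : comNzRingType) n (p : {mpoly R[n]}) :
  mmap (@mpolyC n R) (fun i => 'X_i) p = p.
Proof.
elim/mpoly_ring_ind: p => [c|i|p q IHp IHq|p q IHp IHq].
- by rewrite mmapC.
- by rewrite mmapXi.
- by rewrite rmorphD /= IHp IHq.
- by rewrite rmorphM /= IHp IHq.
Qed.

(** * Places *)

(** A ring morphism from a subring of E to F, presented by its graph.  Graphs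
    compose and extend without any subring type having to be built, and the last
    clause alone makes the relation single-valued. *)
Definition place (E F : comNzRingType) (Phi : E -> F -> Prop) : Prop :=
  [/\ Phi 1 1,
      forall x y x' y', Phi x y -> Phi x' y' -> Phi (x - x') (y - y'),
      forall x y x' y', Phi x y -> Phi x' y' -> Phi (x * x') (y * y') &
      forall y, Phi 0 y -> y = 0].

Definition polyrel (E F : nzRingType) (Phi : E -> F -> Prop)
    (P : {poly E}) (P' : {poly F}) : Prop := forall i, Phi P`_i P'`_i.

Section Place.
Variables (E F : comNzRingType) (Phi : E -> F -> Prop).
Hypothesis pl : place Phi.

Lemma place1 : Phi 1 1. Proof. by case: pl. Qed.
Lemma placeB x y x' y' : Phi x y -> Phi x' y' -> Phi (x - x') (y - y').
Proof. by case: pl => _ h _ _; apply: h. Qed.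
Lemma placeM x y x' y' : Phi x y -> Phi x' y' -> Phi (x * x') (y * y').
Proof. by case: pl => _ _ h _; apply: h. Qed.
Lemma place0_eq y : Phi 0 y -> y = 0. Proof. by case: pl => _ _ _; apply. Qed.
Lemma place0 : Phi 0 0. Proof. by rewrite -[X in Phi X](subrr 1) -(subrr 1); apply: placeB place1 place1. Qed.
Lemma placeN x y : Phi x y -> Phi (- x) (- y).
Proof. by move=> h; rewrite -[- x]sub0r -[- y]sub0r; apply: placeB place0 h. Qed.
Lemma placeD x y x' y' : Phi x y -> Phi x' y' -> Phi (x + x') (y + y').
Proof.
by move=> h h'; rewrite -[x']opprK -[y']opprK; apply: placeB h (placeN h').
Qed.
Lemma place_inj x y y' : Phi x y -> Phi x y' -> y = y'.
Proof.
by move=> h h'; apply/eqP; rewrite -subr_eq0; apply/eqP/place0_eq;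
  rewrite -[X in Phi X](subrr x); apply: placeB.
Qed.
Lemma placeX x y k : Phi x y -> Phi (x ^+ k) (y ^+ k).
Proof.
move=> h; elim: k => [|k IH]; first by rewrite !expr0; apply: place1.
by rewrite !exprS; apply: placeM.
Qed.
Lemma place_nat k : Phi k%:R k%:R.
Proof.
elim: k => [|k IH]; first exact: place0.
by rewrite -!natr1; apply: placeD IH place1.
Qed.
Lemma place_int k : Phi k%:~R k%:~R.
Proof. by case: k => k; [apply: place_nat | rewrite NegzE !mulrNz; apply/placeN/place_nat]. Qed.
Lemma place_sum I (r : seq I) (P : pred I) (f : I -> E) (g : I -> F) :
  (forall i, Phi (f i) (g i)) ->
  Phi (\sum_(i <- r | P i) f i) (\sum_(i <- r | P i) g i).
Proof.
move=> h; elim/big_ind2: _ => //; first exact: place0.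
by move=> *; apply: placeD.
Qed.

Lemma place_mmap (R : comNzRingType) n (f : {rmorphism R -> E})
    (g : {rmorphism R -> F}) (a : 'I_n -> E) (b : 'I_n -> F) (p : {mpoly R[n]}) :
  (forall c, Phi (f c) (g c)) -> (forall i, Phi (a i) (b i)) ->
  Phi (mmap f a p) (mmap g b p).
Proof.
move=> hc hi; elim/mpoly_ring_ind: p => [c|i|p q IHp IHq|p q IHp IHq].
- rewrite !mmapC; exact: hc.
- rewrite !mmapXi; exact: hi.
- by rewrite !rmorphD; apply: placeD.
- by rewrite !rmorphM; apply: placeM.
Qed.

Notation rel := (polyrel Phi).

Lemma polyrelB P P' Q Q' : rel P P' -> rel Q Q' -> rel (P - Q) (P' - Q').
Proof. by move=> h h' i; rewrite !coefB; apply: placeB. Qed.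
Lemma polyrelM P P' Q Q' : rel P P' -> rel Q Q' -> rel (P * Q) (P' * Q').
Proof.
move=> h h' i; rewrite !coefM; apply: place_sum => j; exact: placeM.
Qed.
Lemma polyrelD P P' Q Q' : rel P P' -> rel Q Q' -> rel (P + Q) (P' + Q').
Proof. by move=> h h' i; rewrite !coefD; apply: placeD. Qed.
Lemma polyrelC x y : Phi x y -> rel x%:P y%:P.
Proof. by move=> h i; rewrite !coefC; case: eqP => // _; apply: place0. Qed.
Lemma polyrelX : rel 'X 'X.
Proof. by move=> i; rewrite !coefX; case: eqP => _; [apply: place1|apply: place0]. Qed.

Lemma polyrel_place : place rel.
Proof.
split; [exact/polyrelC/place1|exact: polyrelB|exact: polyrelM|].
by move=> P h; apply/polyP=> i; rewrite coef0; apply: place0_eq; have := h i; rewrite coef0.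
Qed.

Lemma polyrel_horner P P' x y : rel P P' -> Phi x y -> Phi P.[x] P'.[y].
Proof.
move=> h hx; pose k := maxn (size P) (size P').
rewrite (horner_coef_wide x (leq_maxl _ _ : _ <= k)%N).
rewrite (horner_coef_wide y (leq_maxr _ _ : _ <= k)%N).
by apply: place_sum => i; apply: placeM; [apply: h | apply: placeX].
Qed.

Lemma polyrel_ex (P : {poly E}) :
  (forall x, x \in (P : seq E) -> exists y, Phi x y) -> exists P', rel P P'.
Proof.
elim/poly_ind: P => [|P c IH] h; first by exists 0; rewrite -!polyC0; apply/polyrelC/place0.
have h0 i : exists y, Phi (P * 'X + c%:P)`_i y.
  have [lt|le] := ltnP i (size (P * 'X + c%:P)); first exact/h/mem_nth.
  by rewrite nth_default //; exists 0; apply: place0.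
have [P' hP'] : exists P', rel P P'.
  apply: IH => x /(nthP 0) [i _ <-].
  by have := h0 i.+1; rewrite coefD coefMX coefC /= addr0.
have [y hy] := h0 0%N; move: hy; rewrite coefD coefMX coefC /= add0r => hy.
exists (P' * 'X + y%:P); apply: polyrelD (polyrelC hy).
exact: polyrelM hP' polyrelX.
Qed.

End Place.

Lemma place_comp (E F G : comNzRingType) (Phi : E -> F -> Prop) (Psi : F -> G -> Prop) :
  place Phi -> place Psi -> place (fun x z => exists2 y, Phi x y & Psi y z).
Proof.
move=> h k; split.
- by exists 1; apply: place1.
- move=> x z x' z' [y hy ky] [y' hy' ky'].
  by exists (y - y'); [apply: (placeB h) | apply: (placeB k)].
- move=> x z x' z' [y hy ky] [y' hy' ky'].
  by exists (y * y'); [apply: (placeM h) | apply: (placeM k)].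
- by move=> z [y /(place0_eq h) -> /(place0_eq k)].
Qed.

(** A place defined on the whole image of A is a genuine ring morphism on A; this
    is how morphisms out of R and out of fraction fields are obtained. *)
Lemma place_rmorphism (A E F : comNzRingType) (Phi : E -> F -> Prop)
    (iota : {rmorphism A -> E}) :
  place Phi -> (forall a, exists y, Phi (iota a) y) ->
  exists phi : {rmorphism A -> F}, forall a, Phi (iota a) (phi a).
Proof.
move=> pl /choice [f hf].
have fB : zmod_morphism f.
  by move=> x y; apply: (place_inj pl) (hf _) _; rewrite rmorphB; apply: (placeB pl).
have fM : monoid_morphism f.
  split; first by apply: (place_inj pl) (hf _) _; rewrite rmorph1; apply: (place1 pl).
  by move=> x y; apply: (place_inj pl) (hf _) _; rewrite rmorphM; apply: (placeM pl).
pose m1 := GRing.isZmodMorphism.Build A F f fB.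
pose m2 := GRing.isMonoidMorphism.Build A F f fM.
pose phi : {rmorphism A -> F} := HB.pack f m1 m2.
by exists phi.
Qed.

(** The extension of psi to the localization of the image of D at the elements
    that psi does not kill. *)
Definition ratiorel (D : comNzRingType) (E F : fieldType) (iota : {rmorphism D -> E})
    (psi : {rmorphism D -> F}) (x : E) (y : F) : Prop :=
  exists a b, [/\ psi b != 0, x = iota a / iota b & y = psi a / psi b].

Section Ratiorel.
Variables (D : comNzRingType) (E F : fieldType).
Variables (iota : {rmorphism D -> E}) (psi : {rmorphism D -> F}).

Lemma ratiorel_id a : ratiorel iota psi (iota a) (psi a).
Proof. by exists a, 1; rewrite !rmorph1 !divr1 oner_neq0. Qed.

Lemma ratiorel_place : (forall a, iota a = 0 -> psi a = 0) -> place (ratiorel iota psi).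
Proof.
move=> ker; have nz b : psi b != 0 -> iota b != 0.
  by apply: contraNneq => /ker ->.
split.
- by rewrite -(rmorph1 iota) -[X in ratiorel _ _ _ X](rmorph1 psi); apply: ratiorel_id.
- move=> _ _ _ _ [a [b [hb -> ->]]] [a' [b' [hb' -> ->]]].
  exists (a * b' - a' * b), (b * b'); split; first by rewrite rmorphM mulf_neq0.
    by rewrite rmorphB !rmorphM -!mulNr addf_div ?nz.
  by rewrite rmorphB !rmorphM -!mulNr addf_div.
- move=> _ _ _ _ [a [b [hb -> ->]]] [a' [b' [hb' -> ->]]].
  exists (a * a'), (b * b'); split; first by rewrite rmorphM mulf_neq0.
    by rewrite !rmorphM mulf_div.
  by rewrite !rmorphM mulf_div.
- move=> _ [a [b [hb /esym/eqP + ->]]].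
  rewrite mulf_eq0 invr_eq0 (negPf (nz _ hb)) orbF => /eqP/ker ->.
  by rewrite mul0r.
Qed.

End Ratiorel.

Lemma tofrac_inj (D : idomainType) : injective (@tofrac D).
Proof. by move=> x y /eqP; rewrite tofrac_eq => /eqP. Qed.

Lemma fractionE (D : idomainType) (x : {fraction D}) :
  exists a b, b != 0 /\ x = tofrac a / tofrac b.
Proof.
elim/quotW: x => r; exists r.1, r.2; split; first exact: denom_ratioP.
have hb := denom_ratioP r.
apply/eqP; rewrite -(inj_eq (mulIf (_ : tofrac r.2 != 0))) ?tofrac_eq0 //.
rewrite divfK ?tofrac_eq0 // !piE /= /FracField.mulf.
by rewrite FracField.equivfE !numden_Ratio ?mulr1 ?mul1r ?oner_eq0 ?mulf_neq0 ?oner_neq0 // mulrC.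
Qed.

(** The place [ratiorel tofrac h] is everywhere defined when h is injective, so
    it is the required morphism. *)
Lemma fraction_lift (D : idomainType) (L : fieldType) (h : {rmorphism D -> L}) :
  (forall a, h a = 0 -> a = 0) ->
  exists H : {rmorphism {fraction D} -> L}, forall a, H (tofrac a) = h a.
Proof.
move=> inj; have pl : place (ratiorel (@tofrac D) h).
  by apply: ratiorel_place => a /eqP; rewrite tofrac_eq0 => /eqP ->; rewrite rmorph0.
have [|H hH] := @place_rmorphism {fraction D} _ _ _ idfun pl.
  move=> x; have [a [b [hb ->]]] := fractionE x.
  exists (h a / h b), a, b; split=> //.
  by apply: contraNneq hb => /inj ->.
by exists H => a; apply: (place_inj pl) (hH _) _; apply: ratiorel_id.
Qed.

(** * Specialization to prime fields *)

Lemma natr_nonroot (R : idomainType) (P : {poly R}) :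
  [pchar R] =i pred0 -> P != 0 -> exists k : nat, P.[k%:R] != 0.
Proof.
move=> /pcharf0P ch nzP; apply/not_existsP => h.
have inj : injective (fun k : nat => k%:R : R).
  move=> i j; wlog le : i j / (i <= j)%N => [hw|].
    by case/orP: (leq_total i j) => le e; [|symmetry]; apply: hw.
  move=> /eqP; rewrite eq_sym -subr_eq0 -natrB // ch subn_eq0 => le'.
  by apply/eqP; rewrite eqn_leq le.
have := max_poly_roots nzP (rs := [seq k%:R | k <- iota 0 (size P)]).
rewrite size_map size_iota ltnn => ab; suff: false by [].
apply: ab; last by rewrite map_inj_uniq ?iota_uniq.
by apply/allP => _ /mapP [k _ ->]; rewrite /root; apply/negPn/negP/h.
Qed.

(** Schur's argument: with c = H(0) nonzero, H(c M j) = c (1 + M w) for some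
    integer w, and for suitable j the second factor is not 1 or -1; its prime
    divisors are prime to M. *)
Lemma schur_prime_root (H : {poly int}) (M : int) :
  (1 < size H)%N -> M != 0 ->
  exists p, [/\ prime p, ~~ (p%:Z %| M)%Z & exists k, (p%:Z %| H.[k])%Z].
Proof.
move=> sH nzM; pose c := H.[0].
have big k : H.[k] = 0 ->
    exists p, [/\ prime p, ~~ (p%:Z %| M)%Z & exists k, (p%:Z %| H.[k])%Z].
  move=> hk; have [p lt pp] := prime_above `|M|%N.
  exists p; split=> //; last by exists k; rewrite hk dvdz0.
  apply/negP; rewrite dvdzE /= => /dvdn_leq; rewrite absz_gt0 nzM => /(_ isT).
  by rewrite leqNgt lt.
have [c0|nzc] := eqVneq c 0; first exact: (big 0).
have [w hw] : exists w, H = w * 'X + c%:P.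
  have : root (H - c%:P) 0 by rewrite /root !hornerE subrr.
  by move=> /factor_theorem [w]; rewrite subr0 => e; exists w; rewrite -e subrK.
(* H1 - c and H1 + c are nonzero, so some integer j is a root of neither. *)
pose H1 := H \Po ((c * M) *: 'X).
have sH1 : (1 < size H1)%N.
  by rewrite size_comp_poly2 // size_scale ?size_polyX // mulf_neq0.
have nz (d : int) : H1 - d%:P != 0.
  apply: contraTneq sH1 => /eqP; rewrite subr_eq0 => /eqP ->.
  by rewrite -leqNgt size_polyC_leq1.
have ch : [pchar int] =i pred0 by apply: Num.Theory.pchar_num.
have [j] := natr_nonroot ch (mulf_neq0 (nz c) (nz (- c))).
rewrite hornerM mulf_eq0 negb_or => /andP [].
rewrite !hornerD !hornerN !hornerC opprK.
rewrite horner_comp !hornerE; set y := c * M * _; set v := 1 + M * (j%:R * w.[y]).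
have e : H.[y] = c * v.
  by rewrite hw !hornerE /v {2}/y mulrDr mulr1 addrC; congr (_ + _); rewrite !mulrA mulrC !mulrA.
rewrite e subr_eq0 addr_eq0 => h1 h2.
have [v0|nzv] := eqVneq v 0; first by apply: (big y); rewrite e v0 mulr0.
have ltv : (1 < `|v|)%N.
  rewrite ltn_neqAle absz_gt0 nzv andbT eq_sym; apply/eqP => v1.
  move: h1 h2; case: (intP v) v1 => [|m|m] //= [->] /=; rewrite ?mulr1 ?eqxx // mulrN1 eqxx //.
pose p := pdiv `|v|; have pp : prime p by apply: pdiv_prime.
have pv : (p%:Z %| v)%Z by rewrite dvdzE /= pdiv_dvd.
exists p; split=> //; last by exists y; rewrite e dvdz_mull.
apply/negP => pM; have : (p%:Z %| 1%R)%Z.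
  by rewrite -[1%R](addrK (M * (j%:R * w.[y]))) rpredB // dvdz_mulr.
by rewrite dvdzE /= dvdn1 => /eqP p1; rewrite p1 in pp.
Qed.

(** Besides the finite set s, a root of a prescribed polynomial is required in the
    prime field: without it the property would not pass from E to its algebraic
    extensions. *)
Definition root_specializable (E : fieldType) : Prop :=
  forall (s : seq E) (P : {poly E}), P \is monic -> (1 < size P)%N ->
  exists2 p, prime p & exists Phi : E -> 'F_p -> Prop,
    [/\ place Phi, forall x, x \in s -> exists y, Phi x y &
        exists P' t, polyrel Phi P P' /\ P'.[t] = 0].

Lemma fraction_common_denominator (D : idomainType) (s : seq {fraction D}) :
  exists2 M : D, M != 0 & forall x, x \in s -> exists a, x = tofrac a / tofrac M.
Proof.
elim: s => [|x s [M nzM IH]]; first by exists 1; rewrite ?oner_neq0.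
have [a [b [nzb ->]]] := fractionE x.
exists (b * M) => [|y]; first exact: mulf_neq0.
rewrite inE => /orP [/eqP ->|/IH [c ->]].
  by exists (a * M); rewrite !rmorphM -mulf_div divff ?mulr1 // tofrac_eq0.
by exists (b * c); rewrite !rmorphM -mulf_div divff ?mul1r // tofrac_eq0.
Qed.

Lemma polyrel_monic (E F : comNzRingType) (Phi : E -> F -> Prop) P P' :
  place Phi -> polyrel Phi P P' -> P \is monic -> P' \is monic /\ size P' = size P.
Proof.
move=> pl h mP.
have sP : (0 < size P)%N by rewrite size_poly_gt0 monic_neq0.
have e1 : P'`_(size P).-1 = 1.
  apply: (place_inj pl) (h _) _; move/monicP: (mP); rewrite /lead_coef => ->.
  exact: place1.
have sP' : size P' = size P.
  apply/eqP; rewrite eqn_leq; apply/andP; split.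
    apply/leq_sizeP => i hi; apply: (place0_eq pl).
    by have := h i; rewrite nth_default.
  rewrite -(prednK sP) ltnNge; apply/negP => le; move: e1.
  by rewrite nth_default // => /eqP; rewrite eq_sym oner_eq0.
by split=> //; apply/monicP; rewrite /lead_coef sP'.
Qed.

Lemma intr_Fp_eq0 p (z : int) : prime p -> (z%:~R == 0 :> 'F_p) = (p%:Z %| z)%Z.
Proof. by move=> pp; rewrite -(dvdz_pcharf (pchar_Fp pp)). Qed.

Lemma specializable_fraction_int : root_specializable {fraction int}.
Proof.
move=> s P mP sP.
have [M nzM hM] := fraction_common_denominator (s ++ (P : seq _)).
have /choice [a ha] (i : nat) : exists a : int, P`_i = tofrac a / tofrac M.
  have [lt|le] := ltnP i (size P).
    by apply: hM; rewrite mem_cat mem_nth ?orbT.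
  by exists 0; rewrite nth_default // rmorph0 mul0r.
have nzM' : tofrac M != 0 by rewrite tofrac_eq0.
pose H := \poly_(i < size P) a i.
have hH i : tofrac H`_i = tofrac M * P`_i.
  rewrite coef_poly; case: ltnP => le; first by rewrite ha mulrC divfK.
  by rewrite nth_default // mulr0 rmorph0.
have sH : (1 < size H)%N.
  have lt : ((size P).-1 < size H)%N.
    rewrite ltnNge; apply/negP => le; have := hH (size P).-1.
    rewrite nth_default // rmorph0; move/monicP: mP; rewrite /lead_coef => -> /eqP.
    by rewrite mulr1 eq_sym (negPf nzM').
  by case: (size P) sP lt => [|[|m]] //= _; apply: leq_trans.
have [p [pp pM [k pk]]] := schur_prime_root sH nzM.
exists p => //; pose psi : {rmorphism int -> 'F_p} := intmul 1.
have pl : place (ratiorel (@tofrac int) psi).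
  by apply: ratiorel_place => x /eqP; rewrite tofrac_eq0 => /eqP ->; rewrite rmorph0.
have dom x : x \in s ++ (P : seq _) -> exists y, ratiorel (@tofrac int) psi x y.
  by move=> /hM [b ->]; exists (psi b / psi M), b, M; split=> //; rewrite intr_Fp_eq0.
exists (ratiorel (@tofrac int) psi); split=> //.
  by move=> x hx; apply: dom; rewrite mem_cat hx.
have [|P' hP'] := polyrel_ex pl (P := P).
  by move=> x hx; apply: dom; rewrite mem_cat hx orbT.
exists P', (psi k); split=> //.
have h1 := placeM pl (ratiorel_id (@tofrac int) psi M)
  (polyrel_horner pl hP' (ratiorel_id (@tofrac int) psi k)).
have e : tofrac M * P.[tofrac k] = tofrac H.[k].
  rewrite -horner_map -hornerZ; congr horner; apply/polyP => i.
  by rewrite coefZ coef_map /= hH.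
rewrite e in h1; have /eqP := place_inj pl h1 (ratiorel_id _ _ _).
have -> : psi H.[k] = 0 by apply/eqP; rewrite intr_Fp_eq0.
by rewrite mulf_eq0 intr_Fp_eq0 // (negPf pM) => /eqP.
Qed.

(** Compose a place of E with evaluation of the variable at an integer that avoids
    the finitely many poles of the data. *)
Lemma specializable_fraction_poly (E : fieldType) :
  [pchar E] =i pred0 -> root_specializable E -> root_specializable {fraction {poly E}}.
Proof.
move=> ch gE s P mP sP.
have [M nzM hM] := fraction_common_denominator (s ++ (P : seq _)).
have [k hk] := natr_nonroot ch nzM.
pose psi : {rmorphism {poly E} -> E} := horner_eval k%:R.
pose Phi := ratiorel (@tofrac {poly E}) psi.
have pl : place Phi.
  by apply: ratiorel_place => x /eqP; rewrite tofrac_eq0 => /eqP ->; rewrite rmorph0.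
have dom x : x \in s ++ (P : seq _) -> exists y, Phi x y.
  by move=> /hM [b ->]; exists (psi b / psi M), b, M.
have [|P1 hP1] := polyrel_ex pl (P := P).
  by move=> x hx; apply: dom; rewrite mem_cat hx orbT.
have [mP1 sP1] := polyrel_monic pl hP1 mP.
have /choice [g hg] x : exists y, x \in s -> Phi x y.
  have [xs|] := boolP (x \in s); last by exists 0.
  by have [|y hy] := dom x; [rewrite mem_cat xs | exists y].
rewrite -sP1 in sP.
have [p pp [Psi [plPsi domPsi [P' [t [hP' ht]]]]]] := gE [seq g x | x <- s] P1 mP1 sP.
exists p => //; exists (fun x z => exists2 y, Phi x y & Psi y z); split.
- exact: place_comp.
- move=> x xs; have [z hz] := domPsi (g x) (map_f _ xs).
  by exists z, (g x) => //; apply: hg.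
- by exists P', t; split=> // i; exists P1`_i.
Qed.

(** The minimal polynomial over an abstract base field E, of which L is not assumed
    to be a finite extension: a nonzero polynomial of least size among those that
    vanish at w, made monic. *)
Lemma algebraic_minpoly (E L : fieldType) (iota : {rmorphism E -> L}) (w : L) :
  algebraicOver iota w ->
  exists Q : {poly E}, [/\ Q \is monic, (1 < size Q)%N, (map_poly iota Q).[w] = 0 &
    forall U : {poly E}, (map_poly iota U).[w] = 0 -> Q %| U].
Proof.
move=> [P0 nzP0 /rootP rP0].
pose X k := `[< exists P : {poly E}, [/\ P != 0, (map_poly iota P).[w] = 0 & size P = k] >].
have exX : exists k, X k by exists (size P0); apply/asboolP; exists P0.
case: (ex_minnP exX) => k /asboolP [P [nzP rP sP]] min.
have lcP : (lead_coef P)^-1 != 0 by rewrite invr_eq0 lead_coef_eq0.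
pose Q := (lead_coef P)^-1 *: P.
have mQ : Q \is monic by rewrite monicE lead_coefZ mulVf // lead_coef_eq0.
have rQ : (map_poly iota Q).[w] = 0 by rewrite map_polyZ hornerZ rP mulr0.
have sQ : size Q = k by rewrite size_scale.
exists Q; split=> //.
  rewrite ltnNge; apply/negP => le; move: rQ.
  have := size1_polyC le => e; rewrite e map_polyC hornerC => /eqP.
  rewrite fmorph_eq0 => /eqP c0; move: (monic_neq0 mQ).
  by rewrite e c0 polyC0 eqxx.
move=> U rU; apply/modp_eq0P; apply/eqP; apply/negPn/negP => nz.
have := ltn_modp U Q; rewrite (monic_neq0 mQ) ltnNge => /negP; apply.
rewrite sQ; apply: min; apply/asboolP; exists (U %% Q); split=> //.
have := congr1 (fun P => (map_poly iota P).[w]) (divp_eq U Q).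
by rewrite rU rmorphD rmorphM /= hornerD hornerM rQ mulr0 add0r.
Qed.

Definition simply_generated (E L : fieldType) (iota : {rmorphism E -> L}) (w x : L) :=
  exists U : {poly E}, x = (map_poly iota U).[w].

(** Every finitely generated field of characteristic zero is a simple algebraic
    extension of a purely transcendental one.  An element algebraic over E is
    absorbed in the primitive element w; a transcendental one enlarges E. *)
Lemma specializable_tower (L : fieldType) (s : seq L) :
  [pchar L] =i pred0 ->
  exists (E : fieldType) (iota : {rmorphism E -> L}) (w : L),
    [/\ root_specializable E, algebraicOver iota w & forall x, x \in s -> simply_generated iota w x].
Proof.
move=> ch; elim: s => [|x s [E [iota [w [gE aw hs]]]]].
  pose h : {rmorphism int -> L} := intmul 1.
  have [a ha|H _] := fraction_lift (h := h).
    case: a ha => k /eqP; rewrite ?NegzE /h /= ?mulrNz ?oppr_eq0.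
      by move=> k0; move: ((pcharf0P L).1 ch k); rewrite -pmulrn in k0; rewrite k0 => /esym/eqP ->.
    by move=> k0; move: ((pcharf0P L).1 ch k.+1); rewrite -pmulrn in k0; rewrite k0.
  exists {fraction int}, H, 0; split=> //; [exact: specializable_fraction_int | exact: algebraic0].
have chE : [pchar E] =i pred0 by move=> p; rewrite -(fmorph_pchar iota) ch.
have [ax|nax] := pselect (algebraicOver iota x).
  have [pw nzpw rpw] := aw; have [px nzpx rpx] := ax.
  have [k] := pchar0_PET nzpx rpx nzpw rpw chE.
  set z := _ - _ => -[[U1 e1] [U2 e2]].
  exists E, iota, z; split=> //.
    apply: algebraic_sub => //.
    rewrite -mulr_natr; apply: algebraic_mul => //.
    by rewrite -(rmorph_nat iota); apply: algebraic_id.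
  move=> y; rewrite inE => /orP [/eqP ->|/hs [U ->]]; first by exists U1.
  by exists (U \Po U2); rewrite map_comp_poly horner_comp e2.
pose h : {rmorphism {poly E} -> L} := horner_eval x \o map_poly iota.
have [a ha|H hH] := fraction_lift (h := h).
  apply/eqP/negPn/negP => nza; apply: nax; exists a => //; exact/eqP.
pose j : {rmorphism E -> {fraction {poly E}}} := @tofrac {poly E} \o polyC.
have ej y : H (j y) = iota y.
  by transitivity (h y%:P); [exact: hH | rewrite /h /= /horner_eval map_polyC hornerC].
have em (U : {poly E}) : map_poly H (map_poly j U) = map_poly iota U.
  by rewrite -map_poly_comp; apply: eq_map_poly => y; apply: ej.
exists {fraction {poly E}}, H, w; split; first exact: specializable_fraction_poly.
  have [P nzP rP] := aw; exists (map_poly j P); first by rewrite map_poly_eq0.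
  by rewrite em.
move=> y; rewrite inE => /orP [/eqP ->|/hs [U ->]].
  exists (tofrac 'X)%:P; rewrite map_polyC hornerC; transitivity (h 'X); last by symmetry; exact: hH.
  by rewrite /h /= map_polyX /horner_eval hornerX.
by exists (map_poly j U); rewrite em.
Qed.

(** On E(w) the place sends w to the root, in the prime field, of the specialized
    minimal polynomial Q'.  It is well defined since a polynomial U vanishing at w
    is a multiple of the monic Q, and the division of U by Q only involves
    coefficients already in the domain of the place. *)
Theorem place_to_prime_field (L : fieldType) (s : seq L) :
  [pchar L] =i pred0 ->
  exists2 p, prime p & exists Phi : L -> 'F_p -> Prop,
    place Phi /\ forall x, x \in s -> exists y, Phi x y.
Proof.
move=> ch; have [E [iota [w [gE aw hs]]]] := specializable_tower s ch.
have [Q [mQ sQ rQ minQ]] := algebraic_minpoly aw.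
have /choice [u hu] x : exists U : {poly E}, x \in s -> x = (map_poly iota U).[w].
  by have [/hs [U e]|] := boolP (x \in s); [exists U | exists 0].
pose cs := flatten [seq (u x : seq E) | x <- s].
have [p pp [Phi [pl dom [Q' [t [hQ' rt]]]]]] := gE cs Q mQ sQ.
have [mQ' sQ'] := polyrel_monic pl hQ' mQ.
exists p => //.
pose Psi x y := exists U U', [/\ polyrel Phi U U', x = (map_poly iota U).[w] & y = U'.[t]].
exists Psi; split; last first.
  move=> x xs; have [|U' hU'] := polyrel_ex pl (P := u x).
    by move=> c hc; apply: dom; apply/flattenP; exists (u x : seq E) => //; apply: map_f.
  by exists U'.[t], (u x), U'; split=> //; apply: hu.
split.
- exists 1, 1; split; first exact: place1 (polyrel_place pl).
    by rewrite rmorph1 hornerC.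
  by rewrite hornerC.
- move=> _ _ _ _ [U [U' [h -> ->]]] [V [V' [k -> ->]]]; exists (U - V), (U' - V').
  by split; [apply: polyrelB | rewrite rmorphB hornerD hornerN | rewrite hornerD hornerN].
- move=> _ _ _ _ [U [U' [h -> ->]]] [V [V' [k -> ->]]]; exists (U * V), (U' * V').
  by split; [apply: polyrelM | rewrite rmorphM hornerM | rewrite hornerM].
move=> _ [U [U' [h /esym rU ->]]].
have {rU} : Q %| U by apply: minQ.
(* Subtract from U the multiple of Q with the same leading term. *)
have [k] := ubnP (size U); elim: k => // k IH in U U' h *; rewrite ltnS => le dv.
have [U0|nzU] := eqVneq U 0.
  suff -> : U' = 0 by rewrite horner0.
  by apply: (place0_eq (polyrel_place pl)); rewrite -U0.
have leQ := dvdp_leq nzU dv.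
pose m := (size U - size Q)%N.
pose c := lead_coef U; pose c' := U'`_(size U).-1.
have hW : polyrel Phi (c%:P * 'X^m * Q) (c'%:P * 'X^m * Q').
  apply: polyrelM => //; apply: polyrelM => //; first exact: (polyrelC pl (h _)).
  exact: (placeX (polyrel_place pl) _ (polyrelX pl)).
have := IH (U - c%:P * 'X^m * Q) (U' - c'%:P * 'X^m * Q') (polyrelB pl h hW).
rewrite hornerD hornerN !hornerM rt mulr0 subr0; apply; last first.
  by rewrite dvdp_sub // dvdp_mull.
have sU : (0 < size U)%N by rewrite size_poly_gt0.
apply: leq_trans (_ : size U <= k)%N => //; rewrite -[X in (_ < X)%N](prednK sU) ltnS.
apply/leq_sizeP => i; rewrite leq_eqVlt => /orP [/eqP <-|lt]; rewrite coefB -mulrA coefCM.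
  rewrite coefXnM; have -> : ((size U).-1 < m)%N = false.
    by rewrite /m -subn1; apply/negbTE; rewrite -leqNgt leq_sub2l // ltnW.
  have -> : ((size U).-1 - m = (size Q).-1)%N by rewrite /m -!subn1 subnAC subKn.
  by move/monicP: mQ; rewrite /lead_coef => ->; rewrite mulr1 subrr.
rewrite coefXnM nth_default; last by rewrite -(prednK sU).
case: ltnP => [_|_]; first by rewrite mulr0 subr0.
rewrite nth_default ?mulr0 ?subr0 //.
rewrite leq_subRL; last by apply: leq_trans (leq_subr _ _) _; rewrite -(prednK sU).
by rewrite /m subnK // -(prednK sU).
Qed.

Section FinGen.
Variables (A : idomainType).
Hypotheses (fgA : fg_ring A) (chA : [pchar A] =i pred0).

Lemma pchar0_extension (L : fieldType) (iota : {rmorphism A -> L}) :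
  injective iota -> [pchar L] =i pred0.
Proof.
move=> inj; apply/pcharf0P => k; rewrite -(rmorph_nat iota) -(rmorph0 iota) (inj_eq inj).
exact: (pcharf0P A).1.
Qed.

(** The form in which specializations are used: a morphism of the finitely
    generated ring A to a prime field, together with an extension of it to finitely
    many elements of an overfield. *)
Lemma fg_place (L : fieldType) (iota : {rmorphism A -> L}) (s : seq L) :
  injective iota ->
  exists2 p, prime p & exists (phi : {rmorphism A -> 'F_p}) (Phi : L -> 'F_p -> Prop),
    [/\ place Phi, forall a, Phi (iota a) (phi a) & forall x, x \in s -> exists y, Phi x y].
Proof.
move=> inj; have [k [a ha]] := fgA.
have [p pp [Phi [pl dom]]] :=
  place_to_prime_field ([seq iota x | x <- a] ++ s) (pchar0_extension inj).
exists p => //; have [|phi hphi] := place_rmorphism (iota := iota) pl; last first.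
  by exists phi, Phi; split=> // x xs; apply: dom; rewrite mem_cat xs orbT.
move=> x; have [q <-] := ha x.
have /choice [b hb] i : exists y, Phi (iota (tnth a i)) y.
  by apply: dom; rewrite mem_cat map_f // mem_tnth.
exists (mmap intr b q); rewrite rmorph_mmap.
have -> : mmap (iota \o intr) (iota \o tnth a) q = mmap intr (iota \o tnth a) q.
  by apply: mmap_ext => // z /=; rewrite rmorph_int.
exact: (@place_mmap _ _ _ pl int k intr intr _ _ _ (place_int pl) hb).
Qed.

End FinGen.

Lemma pchar_mpoly0 (R : idomainType) n : [pchar R] =i pred0 -> [pchar {mpoly R[n]}] =i pred0.
Proof.
move=> /pcharf0P ch; apply/pcharf0P => k.
by rewrite -mpolyC_nat mpolyC_eq0 ch.
Qed.

Lemma fg_mpoly (R : idomainType) n : fg_ring R -> fg_ring {mpoly R[n]}.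
Proof.
move=> [k [a ha]].
pose b := [tuple match split i with inl j => (tnth a j)%:MP | inr j => 'X_j end
  | i < k + n] : (k + n).-tuple {mpoly R[n]}.
exists (k + n)%N, b => p; elim/mpoly_ring_ind: p => [c|i|p q [P <-] [Q <-]|p q [P <-] [Q <-]].
- have [q <-] := ha c; exists (mmap (@mpolyC _ _) (fun i => 'X_(lshift n i)) q).
  rewrite (@mmap_mmap _ _ intr) rmorph_mmap; apply: mmap_ext => [z|i] /=.
    by rewrite rmorph_int.
  by rewrite mmapXi tnth_mktuple; case: (split_ordP (lshift n i)) => j /eqP; rewrite ?eq_shift // => /eqP ->.
- exists 'X_(rshift k i); rewrite mmapXi tnth_mktuple.
  by case: (split_ordP (rshift k i)) => j /eqP; rewrite ?eq_shift // => /eqP ->.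
- by exists (P + Q); rewrite rmorphD.
- by exists (P * Q); rewrite rmorphM.
Qed.

Lemma root_extension (K : fieldType) (P : {poly K}) : (1 < size P)%N ->
  exists (L : fieldType) (kappa : {rmorphism K -> L}) (t : L), (map_poly kappa P).[t] = 0.
Proof.
have [k] := ubnP (size P); elim: k => // k IH in P *; rewrite ltnS => le sP.
have [ir|] := pselect (irreducible_poly P).
  by have [L _ [z /rootP rz _]] := irredp_FAdjoin ir; exists L, (in_alg L), z.
move=> nir; have [Q [sQ dQ nQ]] : exists Q : {poly K}, [/\ size Q != 1%N, Q %| P & ~~ (Q %= P)].
  apply: contra_notP nir => h; split=> // Q sQ dQ.
  by apply/negPn/negP => nQ; apply: h; exists Q.
have nzP : P != 0 by rewrite -size_poly_gt0 ltnW.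
have nzQ : Q != 0 by apply: contraNneq nzP => Q0; move: dQ; rewrite Q0 dvd0p.
have ltQ : (size Q < size P)%N.
  by rewrite ltn_neqAle dvdp_leq // andbT; apply: contraNN nQ; rewrite dvdp_size_eqp.
have sQ1 : (1 < size Q)%N by rewrite ltn_neqAle eq_sym sQ size_poly_gt0.
have [L [kappa [t ht]]] := IH Q (leq_trans ltQ le) sQ1.
exists L, kappa, t; rewrite -(divpK dQ) rmorphM /= hornerM ht mulr0 //.
Qed.

Section PointInjective.
Variables (R : idomainType) (n : nat) (f : 'I_n -> {mpoly R[n]}).
Hypotheses (fgR : fg_ring R) (chR : [pchar R] =i pred0).

Definition prime_injective := forall p, prime p -> forall (phi : {rmorphism R -> 'F_p}) a b,
  (forall i, mmap phi a (f i) = mmap phi b (f i)) -> a =1 b.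

(** If a i and b i differ, the inverse of their difference can be specialized along
    with a and b, so the specialized points remain distinct. *)
Lemma point_injective (L : fieldType) (iota : {rmorphism R -> L}) (a b : 'I_n -> L) :
  prime_injective -> injective iota ->
  (forall i, mmap iota a (f i) = mmap iota b (f i)) -> a =1 b.
Proof.
move=> pinj inj e i; apply/eqP; rewrite -subr_eq0; apply/negPn/negP => nz.
have [p pp [phi [Phi [pl hphi dom]]]] :=
  fg_place fgR chR ((a i - b i)^-1 :: (codom a ++ codom b)) inj.
have /choice [a' ha'] j : exists y, Phi (a j) y.
  by apply: dom; rewrite inE mem_cat codom_f orbT.
have /choice [b' hb'] j : exists y, Phi (b j) y.
  by apply: dom; rewrite inE mem_cat codom_f !orbT.
have [w hw] : exists w, Phi (a i - b i)^-1 w by apply: dom; rewrite inE eqxx.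
have /(_ i) eab : a' =1 b'.
  apply: (pinj p pp phi) => j; apply: (place_inj pl) (place_mmap pl (f j) hphi ha') _.
  by rewrite e; apply: place_mmap.
have := placeM pl (placeB pl (ha' i) (hb' i)) hw.
rewrite eab subrr mul0r divff // => /(place_inj pl (place1 pl)) /eqP.
by rewrite oner_eq0.
Qed.

End PointInjective.

(** * The generic point is rational over its image *)

(** Closure under the field operations is kept in a record so that the subtype it
    cuts out is canonically a field. *)
Record subfieldpred (F : fieldType) := SubfieldPred
  { sfp_car :> {pred F}; sfp_closed : divring_closed sfp_car }.
HB.instance Definition _ (F : fieldType) (S : subfieldpred F) :=
  GRing.isDivringClosed.Build F (sfp_car S) (sfp_closed S).
Definition subfieldtype (F : fieldType) (S : subfieldpred F) := {x : F | x \in sfp_car S}.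
HB.instance Definition _ (F : fieldType) (S : subfieldpred F) :=
  [isSub of subfieldtype S for @sval F (fun x => x \in sfp_car S)].
HB.instance Definition _ (F : fieldType) (S : subfieldpred F) :=
  [Choice of subfieldtype S by <:].
HB.instance Definition _ (F : fieldType) (S : subfieldpred F) :=
  [SubChoice_isSubIntegralDomain of subfieldtype S by <:].
HB.instance Definition _ (F : fieldType) (S : subfieldpred F) :=
  [SubIntegralDomain_isSubField of subfieldtype S by <:].

(** The subfield of F generated by the image of D, as a field type M in its own
    right, with D -> M -> F factoring h. *)
Lemma ratio_field (D : comNzRingType) (F : fieldType) (h : {rmorphism D -> F}) :
  exists (M : fieldType) (j : {rmorphism M -> F}) (e : {rmorphism D -> M}),
    (forall d, j (e d) = h d) /\
    forall m, exists a b, h b != 0 /\ j m = h a / h b.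
Proof.
pose C : {pred F} := fun z => `[< exists a b, h b != 0 /\ z = h a / h b >].
have C_closed : divring_closed C.
  split.
  - by apply/asboolP; exists 1, 1; rewrite !rmorph1 oner_neq0 divr1.
  - move=> _ _ /asboolP [a [b [hb ->]]] /asboolP [c [d [hd ->]]]; apply/asboolP.
    exists (a * d - c * b), (b * d); rewrite rmorphB !rmorphM mulf_neq0 //; split=> //.
    by rewrite -!mulNr addf_div.
  - move=> _ _ /asboolP [a [b [hb ->]]] /asboolP [c [d [hd ->]]]; apply/asboolP.
    have [c0|nzc] := eqVneq (h c) 0.
      by exists 0, 1; rewrite c0 !(mul0r, invr0, mulr0) rmorph0 rmorph1 oner_neq0 mul0r.
    exists (a * d), (b * c); rewrite !rmorphM mulf_neq0 //; split=> //.
    by rewrite invf_div mulf_div.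
pose S := SubfieldPred C_closed.
pose j : {rmorphism subfieldtype S -> F} := val.
have [||e he] := @place_rmorphism D F (subfieldtype S) (fun x y => x = j y) h; last 1 first.
- exists (subfieldtype S), j, e; split=> [d|m]; first by rewrite he.
  by have /asboolP := valP m.
- split.
  + by rewrite rmorph1.
  + by move=> _ y _ y' -> ->; rewrite rmorphB.
  + by move=> _ y _ y' -> ->; rewrite rmorphM.
  + by move=> y /esym/eqP; rewrite fmorph_eq0 => /eqP.
move=> a; have Sa : h a \in sfp_car S.
  by apply/asboolP; exists a, 1; rewrite rmorph1 divr1 oner_neq0.
by exists (exist _ (h a) Sa).
Qed.

Lemma deriv_neq0 (K : fieldType) (Q : {poly K}) :
  [pchar K] =i pred0 -> (1 < size Q)%N -> Q^`() != 0.
Proof.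
move=> /pcharf0P ch sQ; apply/eqP => /polyP/(_ (size Q).-2) /eqP.
have e : ((size Q).-2.+1 = (size Q).-1)%N by case: (size Q) sQ => [|[|k]].
rewrite coef_deriv coef0 e -mulr_natr mulf_eq0 ch.
rewrite -[_`__]/(lead_coef Q) lead_coef_eq0 -size_poly_eq0.
by case: (size Q) sQ => [|[|k]].
Qed.

(** An element w outside the subfield M has another specialization w' over M: a
    conjugate if it is algebraic, which is distinct from w by separability, and a
    translate w + k if it is transcendental.  The finite list vs holds denominators
    that must survive. *)
Lemma second_root (M F : fieldType) (j : {rmorphism M -> F}) (w : F) (vs : seq {poly M}) :
  [pchar F] =i pred0 -> ~ (exists m, w = j m) ->
  (forall v, v \in vs -> (map_poly j v).[w] != 0) ->
  exists (L : fieldType) (kappa : {rmorphism F -> L}) (w' : L),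
    [/\ w' != kappa w,
        forall U, (map_poly j U).[w] = 0 -> (map_poly (kappa \o j) U).[w'] = 0 &
        forall v, v \in vs -> (map_poly (kappa \o j) v).[w'] != 0].
Proof.
move=> ch nw hv; have [aw|naw] := pselect (algebraicOver j w); last first.
  (* A nonroot k of P is a nonzero translation that avoids the zeros of vs. *)
  pose P := 'X * \prod_(v <- vs) (map_poly j v \Po ('X + w%:P)).
  have nzP : P != 0.
    rewrite mulf_neq0 ?polyX_eq0 // prodf_seq_neq0; apply/allP => v vvs /=.
    have := hv v vvs; apply: contraNneq => e0.
    have := congr1 (fun P => P.[0]) e0; rewrite horner_comp !hornerE => ->.
    by [].
  have [k] := natr_nonroot ch nzP; rewrite hornerM hornerX mulf_eq0 negb_or => /andP [nzk].
  rewrite horner_prod prodf_seq_neq0 => /allP nzv.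
  exists F, idfun, (w + k%:R); split=> [|U hU|v vvs].
  - by rewrite -subr_eq0 addrC addKr.
  - have [->|nzU] := eqVneq U 0; first by rewrite rmorph0 horner0.
    by case: naw; exists U => //; apply/eqP.
  - have := nzv v vvs; rewrite /= horner_comp !hornerE addrC.
    by rewrite (eq_map_poly (_ : idfun \o j =1 j)).
have [Q [mQ sQ rQ minQ]] := algebraic_minpoly aw.
have chM : [pchar M] =i pred0 by move=> p; rewrite -(fmorph_pchar j) ch.
have [Q1 eQ1] : exists Q1, map_poly j Q = Q1 * ('X - w%:P).
  by apply/factor_theorem/eqP.
have nzQ1 : Q1 != 0.
  apply: contraTneq mQ => Q10; move: eQ1; rewrite Q10 mul0r => /eqP.
  by rewrite map_poly_eq0 => /eqP ->; rewrite monicE lead_coef0 eq_sym oner_eq0.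
have sQ1 : (1 < size Q1)%N.
  have sz : size Q = (size Q1).+1.
    by rewrite -(size_map_poly j) eQ1 size_Mmonic ?monicXsubC // size_XsubC addn2.
  rewrite ltnNge; apply/negP => le; apply: nw.
  have s1 : size Q1 = 1%N by apply/eqP; rewrite eqn_leq le size_poly_gt0.
  have [c ec] : exists c, Q1 = c%:P by exists Q1`_0%N; apply: size1_polyC; rewrite s1.
  have := congr1 (fun P : {poly F} => P`_0%N) eQ1.
  have := congr1 (fun P : {poly F} => P`_1%N) eQ1.
  rewrite ec !coefCM !coefB !coefX !coefC /= !coef_map /=.
  move: mQ; rewrite monicE /lead_coef sz s1 /= => /eqP ->.
  rewrite rmorph1 sub0r subr0 mulr1 => <-; rewrite mul1r => e.
  by exists (- Q`_0%N); rewrite rmorphN e opprK.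
have [L [kappa [w' rw']]] := root_extension sQ1.
have em U : map_poly (kappa \o j) U = map_poly kappa (map_poly j U) by rewrite map_poly_comp.
have rQ' : (map_poly (kappa \o j) Q).[w'] = 0.
  by rewrite em eQ1 rmorphM /= hornerM rw' mul0r.
have van U : (map_poly j U).[w] = 0 -> (map_poly (kappa \o j) U).[w'] = 0.
  by move=> /minQ /divpK <-; rewrite rmorphM /= hornerM rQ' mulr0.
exists L, kappa, w'; split=> //.
  (* w' = w would make w a double root of Q, hence a root of its derivative. *)
  apply/negP => /eqP ew; move: rw'; rewrite ew horner_map => /eqP.
  rewrite fmorph_eq0 => /eqP r1.
  have : (map_poly j Q^`()).[w] = 0.
    by rewrite -deriv_map eQ1 derivM derivXsubC mulr1 hornerD hornerM r1 hornerXsubC subrr mulr0 addr0.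
  move=> /minQ /(dvdp_leq (deriv_neq0 chM sQ)); rewrite leqNgt.
  by rewrite lt_size_deriv // monic_neq0.
move=> v vvs; apply/negP => /eqP v0.
have /Bezout_eq1_coprimepP [[a b] /= e1] : coprimep Q v.
  pose g := gcdp Q v; pose r := Q %/ g.
  have eQ : Q = r * g by rewrite divpK // dvdp_gcdl.
  have nzg : (map_poly j g).[w] != 0.
    apply: contraNneq (hv v vvs) => g0.
    by rewrite -(divpK (dvdp_gcdr Q v)) rmorphM /= hornerM -/g g0 mulr0.
  have r0 : (map_poly j r).[w] = 0.
    move/eqP: rQ; rewrite eQ rmorphM /= hornerM mulf_eq0 (negPf nzg) orbF.
    by move/eqP.
  have nzr : r != 0.
    by apply: contraTneq mQ => rr; rewrite eQ rr mul0r monicE lead_coef0 eq_sym oner_eq0.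
  have nzg' : g != 0 by apply: contraNneq nzg => ->; rewrite rmorph0 horner0.
  have := dvdp_leq nzr (minQ _ r0); rewrite {1}eQ size_mul // => le.
  rewrite /coprimep -/g eqn_leq size_poly_gt0 nzg' andbT.
  by move: le; case: (size g) => [|[|k]] //; rewrite !addnS /= -[X in (_ <= X)%N]addn0 -addnS leq_add2l.
have := congr1 (fun P => (map_poly (kappa \o j) P).[w']) e1.
rewrite rmorphD !rmorphM rmorph1 /= !hornerE v0 rQ' !mulr0 addr0 => /eqP.
by rewrite eq_sym oner_eq0.
Qed.

Section Birational.
Variables (R : idomainType) (n : nat) (f : 'I_n -> {mpoly R[n]}).
Hypotheses (fgR : fg_ring R) (chR : [pchar R] =i pred0) (pinj : prime_injective f).

(** If all coordinates of x are rational functions over M of the coordinate x k, a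
    second specialization of x k yields a second point with the same image under
    f, as f(x) has its coordinates in M; this contradicts [point_injective]. *)
Lemma rational_coordinate (M F : fieldType) (j : {rmorphism M -> F})
    (rho : {rmorphism R -> M}) (x : 'I_n -> F) k :
  injective rho ->
  (forall i, exists m, mmap (j \o rho) x (f i) = j m) ->
  (forall i, exists u v, (map_poly j v).[x k] != 0 /\
     x i = (map_poly j u).[x k] / (map_poly j v).[x k]) ->
  exists m, x k = j m.
Proof.
move=> inj hf hx; apply: contrapT => nw.
have injj : injective (j \o rho) by move=> a b /= e; apply: inj; exact: fmorph_inj e.
have chF := pchar0_extension chR injj.
have /choice [u /choice [v hv]] := hx.
have [|L [kappa [w' [nw' van nvan]]]] := second_root (vs := codom v) chF nw.
  by move=> _ /codomP [i ->]; case: (hv i).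
pose iota : {rmorphism {poly M} -> F} := horner_eval (x k) \o map_poly j.
pose psi : {rmorphism {poly M} -> L} := horner_eval w' \o map_poly (kappa \o j).
have pl : place (ratiorel iota psi) by apply: ratiorel_place.
have hM c : ratiorel iota psi (j c) (kappa (j c)).
  have := ratiorel_id iota psi c%:P.
  by rewrite /iota /psi /= /horner_eval !map_polyC !hornerC.
pose x' i := psi (u i) / psi (v i).
have hx' i : ratiorel iota psi (x i) (x' i).
  exists (u i), (v i); split=> //; last by case: (hv i).
  by apply: nvan; apply: codom_f.
have ex : x' =1 kappa \o x.
  apply: (@point_injective _ _ f fgR chR _ (kappa \o j \o rho)) => //.
    by move=> a b /= e; apply: injj; exact: fmorph_inj e.
  move=> i; have [m hm] := hf i.
  have h1 : ratiorel iota psi (mmap (j \o rho) x (f i)) (mmap (kappa \o j \o rho) x' (f i)).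
    exact: (@place_mmap _ _ _ pl R n (j \o rho) (kappa \o j \o rho) _ _ _ (fun c => hM (rho c)) hx').
  rewrite (place_inj pl h1 (_ : ratiorel iota psi _ (kappa (j m)))); last by rewrite hm.
  by rewrite -hm rmorph_mmap.
case/negP: nw'; apply/eqP; have := ex k; rewrite /= => <-.
apply: (place_inj pl) (hx' k).
by have := ratiorel_id iota psi 'X; rewrite /iota /psi /= /horner_eval !map_polyX !hornerX.
Qed.

(** The coordinates are removed one at a time from a generating set of F over M:
    the induction hypothesis over M(x k) makes all coordinates rational functions of
    x k, and then x k itself lies in M. *)
Lemma rational_descent (F : fieldType) (x : 'I_n -> F) (ks : seq 'I_n) :
  forall (M : fieldType) (j : {rmorphism M -> F}) (rho : {rmorphism R -> M}),
  injective rho ->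
  (forall i, exists m, mmap (j \o rho) x (f i) = j m) ->
  (forall i, i \in ks \/ exists m, x i = j m) ->
  forall i, exists m, x i = j m.
Proof.
elim: ks => [|k ks IH] M j rho inj hf hx i; first by case: (hx i).
pose h : {rmorphism {poly M} -> F} := horner_eval (x k) \o map_poly j.
have hC c : h c%:P = j c by rewrite /h /= /horner_eval map_polyC hornerC.
have hX : h 'X = x k by rewrite /h /= /horner_eval map_polyX hornerX.
have [M1 [j1 [e [he hr]]]] := ratio_field h.
have all1 : forall i, exists m, x i = j1 m.
  apply: (IH M1 j1 (e \o polyC \o rho)).
  - by move=> a b /= /(congr1 j1); rewrite !he !hC => e1; apply: inj; exact: fmorph_inj e1.
  - move=> i0; have [m hm] := hf i0; exists (e m%:P); rewrite he hC -hm.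
    by apply: mmap_ext => // c /=; rewrite he hC.
  - move=> i0; case: (hx i0) => [|[m ->]]; last first.
      by right; exists (e m%:P); rewrite he hC.
    rewrite inE => /orP [/eqP ->|]; last by left.
    by right; exists (e 'X); rewrite he hX.
have [m hm] : exists m, x k = j m.
  apply: (rational_coordinate inj hf) => i0; have [m ->] := all1 i0.
  by have [a [b [hb ->]]] := hr m; exists a, b.
have [m1 ->] := all1 i; have [a [b [hb ->]]] := hr m1.
have eh c : h c = j c.[m] by rewrite /h /= /horner_eval hm horner_map.
by exists (a.[m] / b.[m]); rewrite !eh fmorph_div.
Qed.

Theorem birational (i : 'I_n) :
  exists u v : {mpoly R[n]}, mmap (@mpolyC n R) f v != 0 /\
    mmap (@mpolyC n R) f v * 'X_i = mmap (@mpolyC n R) f u.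
Proof.
pose tf : {rmorphism {mpoly R[n]} -> {fraction {mpoly R[n]}}} := @tofrac {mpoly R[n]}.
have tinj : injective tf by exact: tofrac_inj.
pose h : {rmorphism {mpoly R[n]} -> {fraction {mpoly R[n]}}} := tf \o mmap (@mpolyC n R) f.
have [M [j [e [he hr]]]] := ratio_field h.
have hC c : h c%:MP = tf c%:MP by rewrite /h /= mmapC.
have [|||m] := @rational_descent _ (fun i => tf 'X_i) (enum 'I_n) M j (e \o @mpolyC n R) _ _ _ i.
- by move=> a b /= /(congr1 j); rewrite !he !hC => /tinj /(congr1 (mcoeff 0%MM)); rewrite !mpolyCK.
- move=> k; exists (e 'X_k); rewrite he /h /= mmapXi -[in RHS](mmap_mpolyC_id (f k)).
  by rewrite rmorph_mmap; apply: mmap_ext => // c /=; rewrite he hC.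
- by move=> k; left; rewrite mem_enum.
have [a [b [hb ->]]] := hr m => eX; exists a, b.
have nzb : mmap (@mpolyC n R) f b != 0 by apply: contraNneq hb => b0; rewrite /h /= b0 rmorph0.
split=> //; apply: tinj; rewrite rmorphM eX mulrC /h /= divfK //.
Qed.

End Birational.

(** * Newton iteration *)

Section Taylor.
Variables (R S : comNzRingType) (phi : {rmorphism R -> S}) (n : nat).

Lemma mmap_taylor (x y : 'I_n -> S) (eps : S) (p : {mpoly R[n]}) :
  exists w, mmap phi (fun i => x i + eps * y i) p =
    mmap phi x p + eps * (\sum_j mmap phi x p^`M(j) * y j) + eps ^+ 2 * w.
Proof.
elim/mpoly_ring_ind: p => [c|i|p q [w hw] [z hz]|p q [w hw] [z hz]].
- exists 0; rewrite !mmapC mulr0 addr0 big1 ?mulr0 ?addr0 // => j _.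
  by rewrite mderivC rmorph0 mul0r.
- exists 0; rewrite !mmapXi mulr0 addr0 (bigD1 i) //= big1 => [|j ne].
    have e0 : (U_(i) - U_(i) = 0 :> 'X_{1..n})%MM by apply/mnmP => k; rewrite mnmBE subnn mnm0E.
    by rewrite mderivX mnm1E eqxx scale1r e0 mpolyX0 rmorph1 mul1r addr0.
  by rewrite mderivX mnm1E eq_sym (negPf ne) scale0r rmorph0 mul0r.
- exists (w + z); rewrite !rmorphD /= hw hz.
  have -> : \sum_j mmap phi x (p + q)^`M(j) * y j =
      \sum_j mmap phi x p^`M(j) * y j + \sum_j mmap phi x q^`M(j) * y j.
    by rewrite -big_split; apply: eq_bigr => j _; rewrite /= mderivD rmorphD mulrDl.
  by rewrite !mulrDr addrACA; congr (_ + _); rewrite addrACA.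
set dp := \sum_j mmap phi x p^`M(j) * y j in hw.
set dq := \sum_j mmap phi x q^`M(j) * y j in hz.
set P := mmap phi x p in hw; set Q := mmap phi x q in hz.
exists (P * z + w * Q + dp * dq + eps * (dp * z + w * dq) + eps ^+ 2 * (w * z)).
rewrite !rmorphM /= hw hz -/P -/Q.
have -> : \sum_j mmap phi x (p * q)^`M(j) * y j = dp * Q + P * dq.
  rewrite mulr_suml mulr_sumr -big_split; apply: eq_bigr => j _ /=.
  by rewrite mderivM rmorphD !rmorphM /= -/P -/Q; ring.
by ring.
Qed.

Lemma mmap_congr (x y : 'I_n -> S) (eps : S) (p : {mpoly R[n]}) :
  exists w, mmap phi (fun i => x i + eps * y i) p = mmap phi x p + eps * w.
Proof.
have [w ->] := mmap_taylor x y eps p.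
by eexists; rewrite -addrA expr2 -mulrA -mulrDr.
Qed.

End Taylor.

Section Newton.
Variables (R : comUnitRingType) (S : comNzRingType) (phi : {rmorphism R -> S}) (n : nat).
Variables (f : 'I_n -> {mpoly R[n]}) (u : R).
Hypotheses (uu : u \is a GRing.unit)
  (det_f : \det (\matrix_(i < n, j < n) (f i)^`M(j)) = u%:MP).

(** Multiplying the error by the inverse of the Jacobian matrix at g, which exists
    at every point because the determinant is a constant unit, at least raises the
    order of the error by one. *)
Lemma newton (b g0 e0 : 'I_n -> S) (tau : S) (N : nat) :
  (forall i, mmap phi g0 (f i) = b i + tau * e0 i) ->
  exists g e : 'I_n -> S, forall i, mmap phi g (f i) = b i + tau ^+ N * e i.
Proof.
move=> h0; case: N => [|N].
  by exists g0, (fun i => tau * e0 i) => i; rewrite expr0 mul1r.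
elim: N => [|N [g [e he]]]; first by exists g0, e0 => i; rewrite expr1.
pose J := map_mx (mmap phi g) (\matrix_(i < n, j < n) (f i)^`M(j)).
have detJ : \det J = phi u by rewrite det_map_mx det_f /= mmapC.
pose y := - (phi u^-1 *: \adj J *m \col_i e i).
have Jy : J *m y = - \col_i e i.
  rewrite mulmxN mulmxA -scalemxAr mul_mx_adj detJ scale_scalar_mx -rmorphM mulVr //.
  by rewrite rmorph1 mul1mx.
have /choice [w hw] i := mmap_taylor phi g (fun j => y j 0) (tau ^+ N.+1) (f i).
exists (fun i => g i + tau ^+ N.+1 * y i 0), (fun i => tau ^+ N * w i) => i.
rewrite hw he; have -> : \sum_j mmap phi g (f i)^`M(j) * y j 0 = - e i.
  have := congr1 (fun A : 'cV_n => A i 0) Jy; rewrite !mxE => <-.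
  by apply: eq_bigr => j _; rewrite !mxE.
rewrite mulrN addrK; congr (_ + _); rewrite mulrA -exprM -exprD.
by congr (tau ^+ _ * _); rewrite muln2 -addnn addSnnS addnC.
Qed.

End Newton.

(** * A polynomial right inverse *)

(** V vanishes at c to order at most its degree, so cancelling it costs no more than
    that many factors. *)
Lemma dvdp_XsubC_cancel (K : fieldType) (V h : {poly K}) (c : K) (N : nat) :
  V != 0 -> ('X - c%:P) ^+ N %| V * h -> ('X - c%:P) ^+ (N - (size V).-1) %| h.
Proof.
move=> nzV; have [m [q]] := multiplicity_XsubC V c; rewrite nzV /= => rq eV.
have nzX k : ('X - c%:P) ^+ k != 0 by rewrite expf_neq0 // polyXsubC_eq0.
have nzq : q != 0 by apply: contraNneq nzV => q0; rewrite eV q0 mul0r.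
have lem : (m <= (size V).-1)%N.
  rewrite eV size_mul // size_exp_XsubC; have := size_poly_gt0 q; rewrite nzq.
  by case: (size q) => // k _; rewrite addSn addnS /= leq_addl.
have [leN|ltm] := leqP N m.
  move=> _; have -> : (N - (size V).-1 = 0)%N.
    by apply/eqP; rewrite subn_eq0 (leq_trans leN).
  by rewrite expr0 dvd1p.
rewrite eV -{1}(subnK (ltnW ltm)) exprD mulrAC dvdp_mul2r // => dv.
apply: dvdp_trans (_ : ('X - c%:P) ^+ (N - m) %| h).
  by apply: dvdp_exp2l; rewrite -eV leq_sub2l.
by rewrite -(Gauss_dvdpr _ (_ : coprimep _ q)) // coprimep_expl // coprimep_sym coprimep_XsubC.
Qed.

Section RightInverse.
Variables (R : idomainType) (n : nat) (f : 'I_n -> {mpoly R[n]}) (u : R).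
Hypotheses (fgR : fg_ring R) (chR : [pchar R] =i pred0).
Hypotheses (uu : u \is a GRing.unit)
  (det_f : \det (\matrix_(i < n, j < n) (f i)^`M(j)) = u%:MP).
Hypothesis pinj : prime_injective f.

Definition prime_surjective := forall p, prime p -> forall (phi : {rmorphism R -> 'F_p}) b,
  exists a, forall i, mmap phi a (f i) = b i.
Hypothesis psurj : prime_surjective.

(** The relation Q(f) x_i = P(f) holds identically, so it can be read along any
    approximate solution g of f(g) = b. *)
Lemma relation_congr (S : comNzRingType) (rho : {rmorphism R -> S}) (b g e : 'I_n -> S)
    (tau : S) (P Q : {mpoly R[n]}) i :
  mmap (@mpolyC n R) f Q * 'X_i = mmap (@mpolyC n R) f P ->
  (forall j, mmap rho g (f j) = b j + tau * e j) ->
  exists w, mmap rho b Q * g i = mmap rho b P + tau * w.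
Proof.
move=> rel he.
have [w hw] := mmap_congr rho b e tau P; have [z hz] := mmap_congr rho b e tau Q.
have := congr1 (mmap rho g) rel; rewrite rmorphM /= mmapXi !mmap_mmap.
rewrite !(mmap_eq _ _ he) hw hz => e1; exists (w - z * g i).
by rewrite mulrBr addrA -e1; ring.
Qed.

(** Write Q(b) = V1 g and P(b) = U1 g with V1, U1 coprime.  If V1 had a root t, then
    t, the Bezout relation between V1 and U1, and the nonvanishing of g could all
    be specialized to some F_p.  Over F_p there is a point above b(t), and the
    Newton solution ga through it satisfies g (V1 ga - U1) = 0 modulo a power of
    X - t high enough to cancel g; hence U1(t) = V1(t) ga(t) = 0, against Bezout.
    In this way common zeros of P and Q on the path b do no harm. *)
Lemma no_pole (A : idomainType) (sigma : {rmorphism R -> A}) (b : 'I_n -> {poly A})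
    (P Q : {mpoly R[n]}) i :
  fg_ring A -> [pchar A] =i pred0 ->
  mmap (@mpolyC n R) f Q * 'X_i = mmap (@mpolyC n R) f P ->
  mmap (polyC \o sigma) b Q != 0 ->
  map_poly (@tofrac A) (mmap (polyC \o sigma) b Q)
    %| map_poly (@tofrac A) (mmap (polyC \o sigma) b P).
Proof.
move=> fgA chA rel nzV; set V := mmap _ b Q in nzV *; set U := mmap _ b P.
pose tf : {rmorphism A -> {fraction A}} := @tofrac A.
have tinj : injective tf by exact: tofrac_inj.
pose VK := map_poly tf V; pose UK := map_poly tf U; rewrite -[X in X %| _]/VK -[X in _ %| X]/UK.
have nzVK : VK != 0.
  apply: contraNneq nzV => V0; apply/eqP/polyP => k; apply: tinj.
  by have := congr1 (fun p : {poly _} => p`_k) V0; rewrite coef_map !coef0 rmorph0.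
pose g := gcdp VK UK; pose V1 := VK %/ g; pose U1 := UK %/ g.
have eV : VK = V1 * g by rewrite divpK // dvdp_gcdl.
have eU : UK = U1 * g by rewrite divpK // dvdp_gcdr.
have nzg : g != 0 by rewrite gcdp_eq0 negb_and nzVK.
have nzV1 : V1 != 0 by apply: contraNneq nzVK => V10; rewrite eV V10 mul0r.
have [s1|sV1] := leqP (size V1) 1.
  rewrite eV eU dvdp_mul2r //.
  have /size_poly1P [c nzc ->] : size V1 == 1%N by rewrite eqn_leq s1 size_poly_gt0.
  by rewrite -[c%:P]mulr1 mul_polyC dvdpZl // dvd1p.
have /Bezout_eq1_coprimepP [[al be] /= bez] : coprimep V1 U1.
  by apply: coprimep_div_gcd; rewrite nzVK.
have [L [kappa [t ht]]] := root_extension sV1.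
pose iota : {rmorphism A -> L} := kappa \o tf.
have iinj : injective iota by move=> x y /= e; apply: tinj; apply: fmorph_inj e.
pose kp := map_poly kappa.
pose s : seq L := t :: kappa (lead_coef g)^-1 ::
  flatten [seq (kp q : seq L) | q <- [:: V1; U1; g; al; be]].
have [p pp [phi [Phi [pl hphi dom]]]] := fg_place fgA chA s iinj.
have ex q : q \in [:: V1; U1; g; al; be] -> exists q', polyrel Phi (kp q) q'.
  move=> hq; apply: (polyrel_ex pl) => x hx; apply: dom; rewrite !inE.
  by apply/orP; right; apply/orP; right; apply/flattenP; exists (kp q : seq L) => //; apply: (map_f (fun q => kp q : seq L)).
have [V1' hV1] : exists q', polyrel Phi (kp V1) q' by apply: ex; rewrite !inE eqxx.
have [U1' hU1] : exists q', polyrel Phi (kp U1) q' by apply: ex; rewrite !inE eqxx orbT.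
have [g' hg] : exists q', polyrel Phi (kp g) q' by apply: ex; rewrite !inE eqxx !orbT.
have [al' hal] : exists q', polyrel Phi (kp al) q' by apply: ex; rewrite !inE eqxx !orbT.
have [be' hbe] : exists q', polyrel Phi (kp be) q' by apply: ex; rewrite !inE eqxx !orbT.
have [t' ht'] : exists t', Phi t t' by apply: dom; rewrite inE eqxx.
have [l' hl'] : exists l', Phi (kappa (lead_coef g)^-1) l'.
  by apply: dom; rewrite !inE eqxx orbT.
have plp := polyrel_place pl.
have relA W : polyrel Phi (kp (map_poly tf W)) (map_poly phi W).
  by move=> k; rewrite !coef_map /=; apply: hphi.
have eV' : map_poly phi V = V1' * g'.
  apply: (place_inj plp) (relA V) _; rewrite -/VK eV /kp rmorphM.
  exact: polyrelM.
have eU' : map_poly phi U = U1' * g'.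
  apply: (place_inj plp) (relA U) _; rewrite -/UK eU /kp rmorphM.
  exact: polyrelM.
have bez' : al' * V1' + be' * U1' = 1.
  apply: (place_inj plp) (_ : polyrel Phi (kp 1) _) _.
    by rewrite -bez /kp rmorphD !rmorphM; apply: polyrelD => //; apply: polyrelM.
  by rewrite /kp rmorph1; apply: (place1 plp).
have rV1' : V1'.[t'] = 0.
  by apply: (place0_eq pl); rewrite -ht; apply: polyrel_horner.
have nzg' : g' != 0.
  apply/eqP => g0; have := placeM pl (hg (size g).-1) hl'.
  rewrite g0 coef0 mul0r coef_map -/(lead_coef g) -rmorphM divff ?lead_coef_eq0 // rmorph1.
  by move=> /(place_inj pl (place1 pl)) /eqP; rewrite oner_eq0.
pose b' j := map_poly phi (b j).
have [a ha] := psurj pp (phi \o sigma) (fun j => (b' j).[t']).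
pose rho' : {rmorphism R -> {poly 'F_p}} := polyC \o (phi \o sigma).
have /choice [e0 he0] j : exists e, mmap rho' (fun k => (a k)%:P) (f j) =
    b' j + ('X - t'%:P) * e.
  have : root ((b' j).[t']%:P - b' j) t' by rewrite /root !hornerE subrr.
  move=> /factor_theorem [e he]; exists e; rewrite mulrC -he addrC subrK -ha.
  by rewrite (rmorph_mmap _ polyC).
(* Precision size g' leaves one factor X - t' after cancelling g'. *)
have [ga [e he]] := newton uu det_f (size g') he0.
have [w hw] := relation_congr rel he.
have eb W : mmap rho' b' W = map_poly phi (mmap (polyC \o sigma) b W).
  rewrite (rmorph_mmap _ (map_poly phi)); apply: mmap_ext => // x /=.
  by rewrite map_polyC.
rewrite !eb -/V -/U eV' eU' in hw.
have : ('X - t'%:P) ^+ (size g') %| g' * (V1' * ga i - U1').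
  by apply/dvdpP; exists w; rewrite mulrC mulrBl mulrAC hw; ring.
move=> /(dvdp_XsubC_cancel nzg').
have -> : (size g' - (size g').-1 = 1)%N.
  by rewrite -subn1 subKn // size_poly_gt0.
rewrite expr1 dvdp_XsubCl /root !hornerE rV1' mul0r sub0r oppr_eq0 => /eqP rU.
have := congr1 (fun q => q.[t']) bez'; rewrite !hornerE rV1' rU !mulr0 addr0 => /eqP.
by rewrite eq_sym oner_eq0.
Qed.

Lemma mmap_size_bound (A : idomainType) (rho : {rmorphism R -> {poly A}}) k
    (p : {mpoly R[k]}) (D : nat) :
  exists B, forall g : 'I_k -> {poly A}, (forall j, (size (g j) <= D)%N) ->
    (size (mmap rho g p) <= B)%N.
Proof.
elim/mpoly_ring_ind: p => [c|i|p q [B hB] [C hC]|p q [B hB] [C hC]].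
- by exists (size (rho c)) => g _; rewrite mmapC.
- by exists D => g hg; rewrite mmapXi.
- exists (maxn B C) => g hg; rewrite rmorphD; apply: leq_trans (size_polyD _ _) _.
  by rewrite geq_max !leq_max hB // hC // orbT.
exists (B + C)%N => g hg; rewrite rmorphM; apply: leq_trans (size_polyMleq _ _) _.
by apply: leq_trans (leq_pred _) _; apply: leq_add; [apply: hB | apply: hC].
Qed.

(** The coefficients of the Newton solution vanish between degree D, which bounds
    all numerators P_i(b), and degree M.  Truncated at D it still solves
    f(g) = b modulo t^M, and both sides have degree less than M; this is why the
    bound B, valid for every g of degree below D, has to be chosen before the
    precision N. *)
Theorem polynomial_right_inverse :
  exists G : 'I_n -> {mpoly R[n]}, forall i, mmap (@mpolyC n R) G (f i) = 'X_i.
Proof.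
pose A := {mpoly R[n]}.
pose rho : {rmorphism R -> {poly A}} := polyC \o @mpolyC n R.
pose c i := mmap idfun (fun _ : 'I_n => 0) (f i).
(* The line from f(0), at time 0, to the generic point, at time 1. *)
pose b i : {poly A} := (c i)%:MP%:P + 'X * ('X_i - (c i)%:MP)%:P.
have b1 i : (b i).[1] = 'X_i by rewrite hornerD hornerM hornerX !hornerC mul1r addrC subrK.
have ev1 (g : 'I_n -> {poly A}) p :
    (mmap rho g p).[1] = mmap (@mpolyC n R) (fun j => (g j).[1]) p.
  rewrite -[LHS]/(horner_eval 1 _) rmorph_mmap; apply: mmap_ext => // x /=.
  by rewrite /horner_eval hornerC.
have /choice [P /choice [Q hPQ]] := birational fgR chR pinj.
pose V i := mmap rho b (Q i); pose U i := mmap rho b (P i).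
have nzV i : V i != 0.
  have [nzQ _] := hPQ i; apply: contraNneq nzQ => V0.
  have : (V i).[1] = 0 by rewrite V0 horner0.
  by rewrite ev1 (mmap_eq _ _ b1) mmap_mpolyC_id => ->; rewrite rmorph0.
have dvd i : map_poly (@tofrac A) (V i) %| map_poly (@tofrac A) (U i).
  by apply: no_pole (hPQ i).2 (nzV i); [apply: fg_mpoly | apply: pchar_mpoly0].
pose D := \max_i size (U i).
have /choice [B hB] i := mmap_size_bound rho (f i) D.
pose M := (D + (\max_i B i + 2))%N.
pose N := (M + \max_i size (V i))%N.
have hB' i : (B i <= M)%N.
  by rewrite /M addnC -addnA; apply: leq_trans (leq_bigmax i) (leq_addr _ _).
have /(newton uu det_f N) [g [e he]] : forall i,
    mmap rho (fun _ => 0) (f i) = b i + 'X * (- ('X_i - (c i)%:MP)%:P).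
  move=> i; rewrite mulrN addrK /c -/(polyC _).
  rewrite (rmorph_mmap _ (@mpolyC n R)) (rmorph_mmap _ polyC).
  by apply: mmap_ext => // j /=; rewrite !rmorph0.
have gap i k : (D <= k < M)%N -> (g i)`_k = 0.
  move=> /andP [leD ltM].
  have [w hw] := relation_congr (hPQ i).2 he.
  pose tf : {rmorphism A -> {fraction A}} := @tofrac A.
  have tinj : injective tf by exact: tofrac_inj.
  pose VK := map_poly tf (V i); pose UK := map_poly tf (U i).
  pose h := UK %/ VK.
  have dv : VK %| UK := dvd i.
  have eU : UK = VK * h by rewrite [RHS]mulrC /h (divpK dv).
  have nzVK : VK != 0.
    by rewrite -size_poly_eq0 size_map_inj_poly ?rmorph0 // size_poly_eq0.
  have : ('X - 0%:P) ^+ N %| VK * (map_poly tf (g i) - h).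
    apply/dvdpP; exists (map_poly tf w); rewrite mulrBr -eU subr0.
    have e1 : VK * map_poly tf (g i) = UK + 'X^N * map_poly tf w.
      by rewrite -[VK * _]rmorphM hw rmorphD rmorphM /= map_polyXn.
    by rewrite e1 [UK + _]addrC addrK mulrC.
  move=> /(dvdp_XsubC_cancel nzVK); rewrite subr0 => /dvdpP [r hr].
  apply: (tinj); rewrite rmorph0 -coef_map /=.
  have -> : map_poly tf (g i) = h + r * 'X^(N - (size VK).-1) by rewrite -hr addrC subrK.
  rewrite coefD coefMXn.
  have sV : size VK = size (V i) by rewrite size_map_inj_poly ?rmorph0.
  have -> : (k < N - (size VK).-1)%N.
    rewrite ltn_subRL; apply: leq_trans (_ : k.+1 + size (V i) <= _)%N.
      by rewrite sV addnC -addSn leq_add2l leq_pred.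
    by apply: leq_add => //; apply: leq_bigmax.
  rewrite addr0 nth_default //; apply: leq_trans leD.
  apply: leq_trans (leq_divp _ _) _; rewrite size_map_inj_poly ?rmorph0 //.
  exact: (leq_bigmax i).
pose gt i := take_poly D (g i).
have hgt i : g i = gt i + 'X^M * drop_poly M (g i).
  rewrite -[LHS](poly_take_drop M) mulrC; congr (_ + _); apply/polyP => k.
  rewrite !coef_take_poly; case: ltnP => lt; case: ltnP => lt' //.
    by rewrite gap // lt' lt.
  by move: (leq_trans (leq_trans lt' (leq_addr _ D)) lt); rewrite ltnn.
exists (fun i => (gt i).[1]) => i; rewrite -ev1 -b1; congr horner.
have [w hw] := mmap_congr rho gt (fun j => drop_poly M (g j)) 'X^M (f i).
rewrite -(mmap_eq _ _ hgt) he in hw.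
have ediff : mmap rho gt (f i) - b i = 'X^M * ('X^(N - M) * e i - w).
  rewrite mulrBr mulrA -exprD subnKC ?leq_addr //.
  by apply/eqP; rewrite subr_eq addrAC -subr_eq opprK -hw addrC.
apply/eqP; rewrite -subr_eq0 ediff mulf_eq0 expf_eq0 polyX_eq0 andbF /=.
apply/negPn/negP => nz.
have : (size (mmap rho gt (f i) - b i)%R <= M)%N.
  apply: leq_trans (size_polyD _ _) _; rewrite geq_max size_polyN; apply/andP; split.
    by apply: leq_trans (hB i _ _) (hB' i) => j; apply: size_take_poly.
  apply: leq_trans (size_polyD _ _) _; rewrite geq_max; apply/andP; split.
    by apply: leq_trans (size_polyC_leq1 _) _; rewrite /M !addnS.
  rewrite mulrC; apply: leq_trans (size_polyMleq _ _) _; rewrite size_polyX addn2 /=.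
  by apply: leq_ltn_trans (size_polyC_leq1 _) _; rewrite /M !addnS.
rewrite ediff mulrC size_mulXn // leqNgt => /negP; apply.
by rewrite -[X in (X < _)%N]addn0 ltn_add2l size_poly_gt0.
Qed.

End RightInverse.

(** * Self-maps of finite types *)

Section Listed.
Variables (T : eqType) (s : seq T) (h : T -> T).
Hypothesis listed : forall x, x \in s.

Lemma listed_surj_inj : (forall y, exists x, h x = y) -> injective h.
Proof.
move=> surj; pose t := undup s.
have ut : uniq (map h t).
  apply: (@leq_size_uniq _ t) => [|y _|]; first exact: undup_uniq.
    have [x <-] := surj y; apply: map_f; rewrite mem_undup; exact: listed.
  by rewrite size_map.
have ht z : z \in t by rewrite mem_undup; apply: listed.
move=> x y e; have lx : (index x t < size t)%N by rewrite index_mem.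
have ly : (index y t < size t)%N by rewrite index_mem.
suff : index x t == index y t.
  by move=> /eqP ei; rewrite -(nth_index x (ht x)) ei nth_index.
rewrite -(nth_uniq (h x) _ _ ut) ?size_map //.
by rewrite !(nth_map x) // !nth_index // e.
Qed.

Lemma listed_inj_surj : injective h -> forall y, exists x, h x = y.
Proof.
move=> inj y; pose t := undup s.
have ht z : z \in t by rewrite mem_undup; apply: listed.
have [_ e] : (size (map h t) = size t) * (map h t =i t).
  apply: uniq_min_size; first by rewrite map_inj_uniq ?undup_uniq.
    by move=> z _; apply: ht.
  by rewrite size_map.
have : y \in map h t by rewrite e.
by move=> /mapP [x _ ->]; exists x.
Qed.

End Listed.

Lemma listed_ffun (T : choiceType) (s : seq T) k :
  (forall x, x \in s) -> exists l : seq {ffun 'I_k -> T}, forall g, g \in l.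
Proof.
move=> hs; exists [seq [ffun i => ssval (h i)] | h : {ffun 'I_k -> seq_sub s} <- enum {: {ffun 'I_k -> seq_sub s}}] => g.
apply/mapP; exists [ffun i => SeqSub (hs (g i))]; first by rewrite mem_enum.
by apply/ffunP => i; rewrite !ffunE.
Qed.

(** * Ideals and finite quotients *)

(** A predicate bundled with its closure property, so that an ideal given by a
    formula becomes an [idealr]. *)
Record idealpred (R : nzRingType) := IdealPred
  { ip_car :> {pred R}; ip_closed : idealr_closed ip_car }.
HB.instance Definition _ (R : nzRingType) (I : idealpred R) :=
  isIdealr.Build R (ip_car I) (ip_closed I).

Section Ideals.
Variable (R : idomainType).
Implicit Types (I m : idealr R).

Definition quot_map I : {rmorphism R -> {ideal_quot I}} := \pi_({ideal_quot I})%qT.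

Lemma quot_map_eq I x y : (quot_map I x == quot_map I y) = (x - y \in I).
Proof. by rewrite Quotient.idealrBE. Qed.

Lemma quot_map_eq0 I x : (quot_map I x == 0) = (x \in I).
Proof. by rewrite -(rmorph0 (quot_map I)) quot_map_eq subr0. Qed.

Lemma quot_map_repr I x : quot_map I (repr x) = x.
Proof. exact: reprK. Qed.

Lemma ideal_of (P : R -> Prop) :
  P 0 -> ~ P 1 -> (forall a x y, P x -> P y -> P (a * x + y)) ->
  exists I : idealr R, forall x, x \in I <-> P x.
Proof.
move=> P0 P1 PD; pose C : {pred R} := fun x => `[< P x >].
have cl : idealr_closed C.
  split; first exact/asboolP.
    by apply/negP => /asboolP.
  by move=> a x y /asboolP Px /asboolP Py; apply/asboolP/PD.
by exists (IdealPred cl : idealr R) => x; split=> /asboolP.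
Qed.

Lemma maximal_inverse m x : maximal_ideal m -> x \notin m -> exists y, 1 - y * x \in m.
Proof.
move=> mx nx; apply: contrapT => h.
have [|||J hJ] := @ideal_of (fun z => exists a, z - a * x \in m).
- by exists 0; rewrite mul0r subr0 idealr0.
- by move=> [a ha]; apply: h; exists a.
- move=> a z w [b hb] [c hc]; exists (a * b + c).
  have -> : a * z + w - (a * b + c) * x = a * (z - b * x) + (w - c * x) by ring.
  by rewrite rpredD // idealMr.
have e : J =i m.
  by apply: mx => z zm; apply/hJ; exists 0; rewrite mul0r subr0.
by move/negP: nx; apply; rewrite -e; apply/hJ; exists 1; rewrite mul1r subrr idealr0.
Qed.

(** Zorn's lemma on the proper ideals that contain u. *)
Lemma nonunit_maximal (u : R) : u \isn't a GRing.unit ->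
  exists2 m : idealr R, maximal_ideal m & u \in m.
Proof.
move=> nu.
(* The last clause lets the empty chain have the empty set as upper bound, and
   forces every nonempty X to be an ideal containing u. *)
pose P (X : set R) := [/\ forall a x y, X x -> X y -> X (a * x + y), ~ X 1 &
  forall x, X x -> X u /\ X 0].
have [F PF tot|A [[AD A1 Au] Amax]] := @Zorn_bigcup R P.
  split.
  - move=> a x y [X FX Xx] [Y FY Yy].
    have [XY|YX] := tot X Y FX FY.
      by exists Y => //; have [h _ _] := PF Y FY; apply: h => //; apply: XY.
    by exists X => //; have [h _ _] := PF X FX; apply: h => //; apply: YX.
  - by move=> [X FX X1]; have [_ h _] := PF X FX; apply: h.
  - move=> x [X FX Xx]; have [_ _ h] := PF X FX; have [Xu X0] := h x Xx.
    by split; exists X.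
have [x Ax] : exists x, A x.
  apply: contrapT => nA; pose B : set R := fun z => exists a, z = a * u.
  apply: (Amax B); last first.
    split.
    - by move=> a x y [b ->] [c ->]; exists (a * b + c); ring.
    - move=> [a a1]; case/negP: nu; apply/unitrPr; exists a; by rewrite mulrC.
    - by move=> x _; split; [exists 1; rewrite mul1r | exists 0; rewrite mul0r].
  split; first by move=> z Az; case: nA; exists z.
  by move=> /(_ u) h; case: nA; exists u; apply: h; exists 1; rewrite mul1r.
have [Auu A0] := Au x Ax.
have [m hm] := ideal_of A0 A1 AD.
exists m; last exact/hm.
move=> J mJ z; apply/idP/idP; last exact: mJ.
move=> Jz; apply/hm; apply: contrapT => nAz.
apply: (Amax (fun w => w \in J)).
  split; first by move=> w /hm; apply: mJ.
  by move=> /(_ z Jz).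
split.
- by move=> a v w Jv Jw; rewrite rpredD // idealMr.
- by rewrite idealr1.
- by move=> w _; split; [apply: mJ; apply/hm | rewrite idealr0].
Qed.

Definition listed_quotient I := exists s : seq {ideal_quot I}, forall x, x \in s.

Lemma nat_in_ideal I : listed_quotient I -> exists2 k : nat, (0 < k)%N & k%:R \in I.
Proof.
move=> [s hs]; apply: contrapT => h.
have inj : injective (fun k : nat => quot_map I k%:R).
  move=> i j; wlog le : i j / (i <= j)%N => [hw|].
    by case/orP: (leq_total i j) => le e; [|symmetry]; apply: hw.
  move=> /esym/eqP; rewrite quot_map_eq -natrB // => hI.
  apply/eqP; rewrite eqn_leq le /= leqNgt -subn_gt0; apply/negP => lt.
  by apply: h; exists (j - i)%N.
have := @uniq_leq_size _ [seq quot_map I k%:R | k <- iota 0 (size s).+1] s.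
rewrite map_inj_uniq ?iota_uniq // size_map size_iota ltnn => ab; suff: false by [].
by apply: ab => // x _; apply: hs.
Qed.

End Ideals.

Section FiniteIndex.
Variables (R : idomainType) (m : idealr R).
Hypotheses (fgR : fg_ring R) (lm : listed_quotient m).

(** The ideal analogue of Schreier's lemma.  Choose representatives r of the classes
    modulo m.  The elements of m expressing how r fails to commute with differences,
    products, the generators of R and 1 generate an ideal J such that the set of
    x with x - r x in J is a subring containing the generators of R, hence all
    of R. *)
Lemma finite_index_fg : exists N (g : 'I_N -> R),
  (forall i, g i \in m) /\ forall x, x \in m -> exists c, x = \sum_i c i * g i.
Proof.
have [k [a ha]] := fgR; have [s hs] := lm.
pose r x : R := repr (quot_map m x).
have rP x : x - r x \in m by rewrite -quot_map_eq quot_map_repr.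
have r_eq x y : x - y \in m -> r x = r y by rewrite -quot_map_eq /r => /eqP ->.
pose S := [seq repr c | c <- s].
have rS x : r x \in S by apply: map_f; apply: hs.
pose gs := [seq x - y - r (x - y) | x <- S, y <- S] ++ [seq x * y - r (x * y) | x <- S, y <- S]
  ++ [seq x - r x | x <- a] ++ [:: 1 - r 1; r 0].
have r0m : r 0 \in m by have := rP 0; rewrite sub0r rpredN.
exists (size gs), (tnth (in_tuple gs)); split.
  move=> i; have := mem_tnth i (in_tuple gs); rewrite !mem_cat => /or4P [].
  - by move=> /allpairsP [[x y] [_ _ ->]].
  - by move=> /allpairsP [[x y] [_ _ ->]].
  - by move=> /mapP [x _ ->].
  - by rewrite !inE => /orP [/eqP ->|/eqP ->].
pose J x := exists c, x = \sum_i c i * tnth (in_tuple gs) i.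
have JD x y : J x -> J y -> J (x + y).
  move=> [c ->] [d ->]; exists (fun i => c i + d i); rewrite -big_split.
  by apply: eq_bigr => i _; rewrite mulrDl.
have JM z x : J x -> J (z * x).
  move=> [c ->]; exists (fun i => z * c i); rewrite mulr_sumr.
  by apply: eq_bigr => i _; rewrite mulrA.
have Jg x : x \in gs -> J x.
  move=> /(@seq_tnthP _ _ _) [i ->]; exists (fun j => (j == i)%:R).
  rewrite (bigD1 i) //= eqxx mul1r big1 ?addr0 // => j /negPf ->; by rewrite mul0r.
have J0 : J (r 0) by apply: Jg; rewrite !mem_cat !inE eqxx !orbT.
pose T x := J (x - r x).
have T1 : T 1 by apply: Jg; rewrite !mem_cat !inE eqxx !orbT.
have TB x y : T x -> T y -> T (x - y).
  rewrite /T => hx hy.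
  have -> : r (x - y) = r (r x - r y).
    apply: r_eq; have -> : x - y - (r x - r y) = (x - r x) - (y - r y) by ring.
    by rewrite rpredB.
  have -> : x - y - r (r x - r y) =
      (x - r x) + (-1 * (y - r y) + (r x - r y - r (r x - r y))) by ring.
  apply: (JD) => //; apply: (JD); first exact: JM.
  apply: Jg; rewrite mem_cat; apply/orP; left; apply/allpairsP.
  by exists (r x, r y); rewrite !rS.
have TM x y : T x -> T y -> T (x * y).
  rewrite /T => hx hy.
  have -> : r (x * y) = r (r x * r y).
    apply: r_eq; have -> : x * y - r x * r y = x * (y - r y) + r y * (x - r x) by ring.
    by rewrite rpredD // idealMr.
  have -> : x * y - r (r x * r y) =
      x * (y - r y) + (r y * (x - r x) + (r x * r y - r (r x * r y))) by ring.
  apply: (JD); first exact: JM.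
  apply: (JD); first exact: JM.
  apply: Jg; rewrite !mem_cat; apply/orP; right; apply/orP; left; apply/allpairsP.
  by exists (r x, r y); rewrite !rS.
have T0 : T 0 by rewrite -(subrr 1); apply: (TB).
have TD x y : T x -> T y -> T (x + y).
  by move=> hx hy; rewrite -[y]opprK -[- y]sub0r; apply: (TB) => //; apply: (TB).
have Tall x : T x.
  have [q <-] := ha x; elim/mpoly_ring_ind: q => [z|i|p q hp hq|p q hp hq].
  - rewrite mmapC; have Tn (j : nat) : T j%:R.
      by elim: j => // j IH; rewrite -natr1; apply: (TD).
    by case: z => j; [apply: Tn | rewrite NegzE raddfN -sub0r; apply: (TB) => //; apply: Tn].
  - rewrite mmapX mmap1U; apply: Jg; rewrite !mem_cat; apply/or4P; apply: Or43.
    by apply: (map_f (fun x => x - r x)); apply: mem_tnth.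
  - by rewrite rmorphD; apply: (TD).
  - by rewrite rmorphM; apply: TM.
move=> x xm; have := Tall x; rewrite /T (r_eq x 0) ?subr0 // => Jx.
by have := JD _ _ Jx J0; rewrite subrK.
Qed.

(** I is the square of m.  R/I is finite since m/I is generated by finitely many
    elements over the finite ring R/m.  If m were equal to I, Nakayama's determinant
    trick would give an element congruent to 1 modulo m that kills m, so m = 0,
    although m contains a positive integer. *)
Lemma finite_index_square : [pchar R] =i pred0 ->
  exists I : idealr R, [/\ listed_quotient I,
    forall x y, x \in m -> y \in m -> x * y \in I & exists2 eps, eps \in m & eps \notin I].
Proof.
move=> ch; have [N [g [gm hg]]] := finite_index_fg; have [s hs] := lm.
have [|||I hI] := @ideal_of R (fun x => exists c, (forall i, c i \in m) /\ x = \sum_(i < N) c i * g i).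
- exists (fun _ => 0); split=> [i|]; first exact: idealr0.
  by rewrite big1 // => i _; rewrite mul0r.
- move=> [c [cm e1]]; have := idealr1 m; rewrite e1 => /negP; apply.
  by apply: rpred_sum => i _; apply: idealMr.
- move=> a _ _ [c [cm ->]] [d [dm ->]]; exists (fun i => a * c i + d i); split.
    by move=> i; rewrite rpredD // idealMr.
  by rewrite mulr_sumr -big_split; apply: eq_bigr => i _ /=; rewrite mulrDl mulrA.
exists I; split.
- have [l hl] := listed_ffun N hs.
  pose v (q : {ideal_quot m}) (c : {ffun 'I_N -> {ideal_quot m}}) :=
    quot_map I (repr q + \sum_(i < N) repr (c i) * g i).
  exists [seq v q c | q <- s, c <- l] => x.
  apply/allpairsP; pose y := repr x; pose q := quot_map m y.
  have [|c hc] := hg (y - repr q); first by rewrite -quot_map_eq quot_map_repr.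
  exists (q, [ffun i => quot_map m (c i)]); split=> //.
  rewrite -[LHS]quot_map_repr; apply/eqP; rewrite quot_map_eq -/y; apply/hI.
  exists (fun i => c i - repr (quot_map m (c i))); split.
    by move=> i; rewrite -quot_map_eq quot_map_repr.
  rewrite /= opprD addrA hc -sumrB; apply: eq_bigr => i _.
  by rewrite ffunE mulrBl.
- move=> x y xm /hg [c ->]; apply/hI; exists (fun i => x * c i); split.
    by move=> i; rewrite mulrC idealMr.
  by rewrite mulr_sumr; apply: eq_bigr => i _; rewrite mulrA.
apply: contrapT => h.
have /choice [c hc] i : exists c, (forall j, c j \in m) /\ g i = \sum_(j < N) c j * g j.
  by apply/hI; apply/negPn/negP => gi; apply: h; exists (g i).
pose C : 'M[R]_N := \matrix_(i, j) c i j.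
have Cg : (1%:M - C) *m (\col_i g i) = 0.
  apply/matrixP => i j; rewrite mulmxBl mul1mx !mxE (hc i).2.
  by rewrite -sumrB big1 // => t _; rewrite !mxE subrr.
have dnm : \det (1%:M - C) \notin m.
  rewrite -quot_map_eq0 -det_map_mx map_mxB map_mx1.
  have -> : map_mx (quot_map m) C = 0.
    by apply/matrixP => i j; rewrite !mxE; apply/eqP; rewrite quot_map_eq0; case: (hc i).
  by rewrite subr0 det1 oner_eq0.
have nzd : \det (1%:M - C) != 0 by apply: contraNneq dnm => ->; rewrite idealr0.
have g0 i : g i = 0.
  have := congr1 (fun A : 'cV_N => (\adj (1%:M - C) *m A) i 0) Cg.
  rewrite mulmxA mul_adj_mx mulmx0 mul_scalar_mx !mxE => /eqP.
  by rewrite mulf_eq0 (negPf nzd) => /eqP.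
have [k k0 /hg [d]] := nat_in_ideal lm.
rewrite big1 => [/eqP|i _]; last by rewrite g0 mulr0.
by rewrite (pcharf0P R).1 // eqn0Ngt k0.
Qed.

End FiniteIndex.

(** * The three implications *)

Lemma invertible_of_inverse (R : comNzRingType) n (f : n.-tuple {mpoly R[n]})
    (G : 'I_n -> {mpoly R[n]}) :
  (forall i, mmap (@mpolyC n R) (tnth f) (G i) = 'X_i) -> invertible_map f.
Proof.
move=> hG p; exists (p \mPo [tuple G i | i < n]).
rewrite /comp_mpoly mmap_mmap -[RHS]mmap_mpolyC_id; apply: mmap_eq => i.
by rewrite tnth_mktuple hG.
Qed.

Section Implications.
Variables (R : idomainType) (n : nat) (f : n.-tuple {mpoly R[n]}).
Hypotheses (fgR : fg_ring R) (chR : [pchar R] =i pred0).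

Let F i := tnth f i.

Lemma invertible_of_bijective_primes (u : R) :
  u \is a GRing.unit -> \det (jacobian f) = u%:MP ->
  prime_injective F -> prime_surjective F -> invertible_map f.
Proof.
move=> uu det_f pinj psurj.
have [G hG] := polynomial_right_inverse fgR chR uu det_f pinj psurj.
apply: (@invertible_of_inverse _ _ _ G) => i.
pose tf : {rmorphism {mpoly R[n]} -> {fraction {mpoly R[n]}}} := @tofrac {mpoly R[n]}.
have tinj : injective tf by exact: tofrac_inj.
pose iota : {rmorphism R -> {fraction {mpoly R[n]}}} := tf \o @mpolyC n R.
have iinj : injective iota.
  by move=> x y /= /tinj /(congr1 (mcoeff 0%MM)); rewrite !mpolyCK.
have ev (a : 'I_n -> {mpoly R[n]}) p : mmap iota (tf \o a) p = tf (mmap (@mpolyC n R) a p).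
  by rewrite rmorph_mmap.
apply: (tinj); rewrite -/F.
apply: (point_injective fgR chR (f := F) (a := tf \o (fun j => mmap (@mpolyC n R) F (G j)))
  (b := tf \o (fun j => 'X_j)) pinj iinj) => k.
by rewrite !ev mmap_mpolyC_id -mmap_mmap hG mmapXi.
Qed.

(** Over F_p a left inverse of f on the finite set F_p^n is also a right inverse,
    so f(G(x)) - x cannot have a nonzero specialization. *)
Lemma invertible_two_sided : invertible_map f ->
  exists G : 'I_n -> {mpoly R[n]}, forall i, mmap (@mpolyC n R) G (F i) = 'X_i.
Proof.
move=> inv; have /choice [G hG] i : exists q, mmap (@mpolyC n R) F q = 'X_i by apply: inv.
exists G => i; apply/eqP; rewrite -subr_eq0; apply/negPn/negP; set r := _ - _ => nzr.
pose tf : {rmorphism {mpoly R[n]} -> {fraction {mpoly R[n]}}} := @tofrac {mpoly R[n]}.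
have tinj : injective tf by exact: tofrac_inj.
have [p pp [phi [Phi [pl hphi dom]]]] :=
  fg_place (fg_mpoly n fgR) (pchar_mpoly0 n chR) [:: (tf r)^-1] tinj.
have nzphi : phi r != 0.
  have [w hw] : exists w, Phi (tf r)^-1 w by apply: dom; rewrite inE.
  apply/eqP => r0; have := placeM pl (hphi r) hw.
  rewrite r0 mul0r divff; last by rewrite tofrac_eq0.
  by move=> /(place_inj pl (place1 pl)) /eqP; rewrite oner_eq0.
pose phi0 : {rmorphism R -> 'F_p} := phi \o @mpolyC n R.
pose fp (q : 'I_n -> {mpoly R[n]}) (h : {ffun 'I_n -> 'F_p}) := [ffun j => mmap phi0 h (q j)].
have comp (a b : 'I_n -> {mpoly R[n]}) h j :
    mmap phi0 (fp a h) (b j) = mmap phi0 h (mmap (@mpolyC n R) a (b j)).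
  by rewrite mmap_mmap; apply: mmap_eq => k; rewrite ffunE.
have FG : cancel (fp F) (fp G).
  by move=> h; apply/ffunP => j; rewrite ffunE comp hG mmapXi.
have := canF_sym FG [ffun j => phi 'X_j] => /ffunP/(_ i).
rewrite !ffunE comp => e; case/negP: nzphi.
have ephi q : phi q = mmap phi0 [ffun j => phi 'X_j] q.
  rewrite -[in LHS](mmap_mpolyC_id q) rmorph_mmap; apply: mmap_ext => // j.
  by rewrite ffunE.
by rewrite /r rmorphB ephi e subrr.
Qed.

Lemma surjective_of_invertible : invertible_map f ->
  forall b : n.-tuple R, exists a : n.-tuple R, poly_map idfun f a = b.
Proof.
move=> /invertible_two_sided [G hG] b.
exists [tuple mmap idfun (tnth b) (G i) | i < n]; apply: eq_from_tnth => i.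
rewrite tnth_mktuple.
have := mmap_mmap idfun G (tnth b) (F i); rewrite hG mmapXi => ->.
by apply: (mmap_eq idfun) => j; rewrite tnth_mktuple.
Qed.

Lemma Fp_natr p (phi : {rmorphism R -> 'F_p}) (x : 'F_p) : phi (x : nat)%:R = x.
Proof. by rewrite rmorph_nat natr_Zp. Qed.

Lemma prime_kernel p (phi : {rmorphism R -> 'F_p}) : prime p ->
  exists2 m : idealr R, maximal_ideal m & forall x, (x \in m) = (phi x == 0).
Proof.
move=> pp; have [|||m hm] := @ideal_of R (fun x => phi x = 0).
- exact: rmorph0.
- by rewrite rmorph1 => /eqP; rewrite oner_eq0.
- by move=> a x y hx hy; rewrite rmorphD rmorphM hx hy mulr0 addr0.
have mE x : (x \in m) = (phi x == 0) by apply/idP/eqP => /hm.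
exists m => // J mJ x; apply/idP/idP; last exact: mJ.
move=> Jx; rewrite mE; apply/negPn/negP => nz.
have := idealr1 J; rewrite -[1](subrK ((((phi x)^-1 : 'F_p) : nat)%:R * x)) => /negP; apply.
rewrite rpredD ?idealMr //; apply: mJ.
by rewrite mE rmorphB rmorphM rmorph1 Fp_natr mulVf // subrr.
Qed.

Section Kernel.
Variables (p : nat) (phi : {rmorphism R -> 'F_p}) (m : idealr R).
Hypothesis mE : forall x, (x \in m) = (phi x == 0).

Lemma kernel_quot x y : quot_map m x = quot_map m y <-> phi x = phi y.
Proof.
split=> /eqP e; apply/eqP; move: e;
  by rewrite quot_map_eq mE rmorphB subr_eq0.
Qed.

Lemma quot_poly_map (a : 'I_n -> R) i :
  tnth (poly_map (quot_map m) f [tuple quot_map m (a j) | j < n]) i =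
  quot_map m (mmap idfun a (F i)).
Proof.
rewrite tnth_mktuple rmorph_mmap; apply: mmap_ext => // j.
by rewrite tnth_mktuple.
Qed.

Lemma prime_poly_map (a : 'I_n -> R) q : phi (mmap idfun a q) = mmap phi (phi \o a) q.
Proof. by rewrite rmorph_mmap. Qed.

End Kernel.

Definition maximal_bijective := forall m : idealr R, maximal_ideal m ->
  bijective (poly_map (quot_map m) f).

Lemma prime_injective_of_maximal : maximal_bijective -> prime_injective F.
Proof.
move=> bij p pp phi a b e i; have [m mx mE] := prime_kernel phi pp.
pose l (c : 'I_n -> 'F_p) j : R := (c j : nat)%:R.
have phil c : phi \o l c =1 c by move=> j; rewrite /= Fp_natr.
have : [tuple quot_map m (l a j) | j < n] = [tuple quot_map m (l b j) | j < n].
  apply: (bij_inj (bij m mx)); apply: eq_from_tnth => j; rewrite !quot_poly_map.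
  apply/(kernel_quot mE); rewrite !prime_poly_map.
  by rewrite (mmap_eq _ _ (phil a)) (mmap_eq _ _ (phil b)).
move=> /(congr1 (fun t => tnth t i)); rewrite !tnth_mktuple => /(kernel_quot mE).
by rewrite !Fp_natr.
Qed.

Lemma prime_surjective_of_maximal : maximal_bijective -> prime_surjective F.
Proof.
move=> bij p pp phi b; have [m mx mE] := prime_kernel phi pp.
have [g _ hg] := bij m mx.
pose c := g [tuple quot_map m (b j : nat)%:R | j < n].
pose a j : R := repr (tnth c j).
exists (phi \o a) => i; rewrite -prime_poly_map -[RHS](Fp_natr phi).
apply/(kernel_quot mE); rewrite -quot_poly_map.
have -> : [tuple quot_map m (a j) | j < n] = c.
  by apply: eq_from_tnth => j; rewrite tnth_mktuple quot_map_repr.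
by rewrite hg tnth_mktuple.
Qed.

Lemma listed_tuple (T : choiceType) : (exists s : seq T, forall x, x \in s) ->
  exists l : seq (n.-tuple T), forall t, t \in l.
Proof.
move=> [s hs]; have [l hl] := listed_ffun n hs.
exists [seq [tuple h i | i < n] | h : {ffun 'I_n -> T} <- l] => t.
apply/mapP; exists [ffun i => tnth t i]; first exact: hl.
by apply: eq_from_tnth => i; rewrite tnth_mktuple ffunE.
Qed.

Section FromSurjective.
Hypothesis surj : forall b : n.-tuple R, exists a : n.-tuple R, poly_map idfun f a = b.

Lemma quot_surjective (m : idealr R) b : exists a, poly_map (quot_map m) f a = b.
Proof.
have [a ha] := surj [tuple repr (tnth b i) | i < n].
exists [tuple quot_map m (tnth a i) | i < n]; apply: eq_from_tnth => i.
rewrite quot_poly_map.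
have -> : mmap idfun (tnth a) (F i) = repr (tnth b i).
  by have := congr1 (fun t => tnth t i) ha; rewrite !tnth_mktuple.
by rewrite quot_map_repr.
Qed.

Lemma quot_injective (m : idealr R) : listed_quotient m -> injective (poly_map (quot_map m) f).
Proof.
move=> /listed_tuple [l hl]; apply: (listed_surj_inj hl); exact: quot_surjective.
Qed.

Lemma quot_bijective (m : idealr R) : listed_quotient m -> bijective (poly_map (quot_map m) f).
Proof.
move=> lm; have /choice [g hg] := quot_surjective (m := m).
by exists g => // x; apply: (quot_injective lm).
Qed.

(** The kernel vector v comes from counting: an injective linear endomorphism of
    the finite module (R/m)^n is surjective, so its matrix has a right inverse and
    a nonzero determinant.  Since m^2 contains eps m and eps^2, the Taylor expansion
    gives f(a + eps v) = f(a) modulo m^2, while eps v_j is not in m^2 for v_j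
    outside m. *)
Lemma jacobian_notin_maximal (m : idealr R) (a : 'I_n -> R) :
  maximal_ideal m -> listed_quotient m -> mmap idfun a (\det (jacobian f)) \notin m.
Proof.
move=> mx lm; apply/negP => detm.
have [I [lI mmI [eps epsm epsI]]] := finite_index_square fgR lm chR.
pose B := map_mx (mmap idfun a) (jacobian f).
pose QB := map_mx (quot_map m) B.
have detQ : \det QB = 0 by apply/eqP; rewrite !det_map_mx quot_map_eq0.
pose h (v : {ffun 'I_n -> {ideal_quot m}}) : {ffun 'I_n -> {ideal_quot m}} :=
  [ffun i => \sum_j QB i j * v j].
have [s hs] := lm; have [l hl] := listed_ffun n hs.
have [v [nzv hv]] : exists v, v <> 0 /\ h v = 0.
  apply: contrapT => nv.
  have inj : injective h.
    move=> x y e; apply/eqP; rewrite -subr_eq0; apply/negPn/negP => /eqP nz.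
    apply: nv; exists (x - y); split=> //; apply/ffunP => i.
    have /ffunP/(_ i) := e; rewrite !ffunE => e'.
    transitivity (\sum_j QB i j * x j - \sum_j QB i j * y j); last by rewrite e' subrr.
    by rewrite -sumrB; apply: eq_bigr => j _; rewrite !ffunE mulrBr.
  have /choice [w hw] k := listed_inj_surj hl inj [ffun i => (i == k)%:R].
  have : QB *m (\matrix_(i, k) w k i) = 1%:M.
    apply/matrixP => i k; rewrite !mxE.
    have /ffunP/(_ i) := hw k; rewrite !ffunE => <-.
    by apply: eq_bigr => j _; rewrite [X in _ * X]mxE.
  by move=> /(congr1 determinant); rewrite det_mulmx detQ mul0r det1 => /esym/eqP; rewrite oner_eq0.
pose vr j : R := repr (v j).
have Bv i : \sum_j B i j * vr j \in m.
  rewrite -quot_map_eq0 rmorph_sum; apply/eqP.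
  have /ffunP/(_ i) := hv; rewrite !ffunE => hv0; rewrite -[RHS]hv0; apply: eq_bigr => j _.
  by rewrite rmorphM quot_map_repr /QB [in RHS]mxE.
have [j nvj] : exists j, vr j \notin m.
  apply: contrapT => nj; apply: nzv; apply/ffunP => j; rewrite ffunE -[LHS]quot_map_repr.
  by apply/eqP; rewrite quot_map_eq0; apply/negPn/negP => hj; apply: nj; exists j.
have : [tuple quot_map I (a i + eps * vr i) | i < n] = [tuple quot_map I (a i) | i < n].
  apply: (quot_injective lI); apply: eq_from_tnth => i.
  rewrite !quot_poly_map; apply/eqP; rewrite quot_map_eq.
  have [w ->] := mmap_taylor idfun a vr eps (F i).
  rewrite addrAC [_ + _ - _]addrAC subrr add0r rpredD //.
    have -> : \sum_k mmap idfun a (F i)^`M(k) * vr k = \sum_k B i k * vr k.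
      by apply: eq_bigr => k _; rewrite !mxE.
    exact: mmI.
  by rewrite mulrC idealMr // expr2 mmI.
move=> /(congr1 (fun t => tnth t j)); rewrite !tnth_mktuple => /eqP.
rewrite quot_map_eq addrC addKr => ev.
have [y hy] := maximal_inverse mx nvj.
case/negP: epsI; have -> : eps = y * (eps * vr j) + eps * (1 - y * vr j) by ring.
by apply: rpredD; [apply: idealMr | apply: mmI].
Qed.

(** Along the generic line t z through the origin, det Jf becomes a polynomial Pt
    in t over R[z].  A root of Pt in an extension field specializes to a zero of
    det Jf in some F_p^n, so Pt is constant, and the values at t = 1 and t = 0
    identify det Jf with its constant term. *)
Lemma jacobian_unit : finite_quotients R ->
  exists2 u : R, u \is a GRing.unit & \det (jacobian f) = u%:MP.
Proof.
move=> fq; pose P := \det (jacobian f).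
pose A := {mpoly R[n]}.
pose rho : {rmorphism R -> {poly A}} := polyC \o @mpolyC n R.
pose Pt := mmap rho (fun i => 'X * ('X_i)%:P) P.
have ev (z : A) : Pt.[z] = mmap (@mpolyC n R) (fun i => z * 'X_i) P.
  rewrite -[LHS]/(horner_eval z _) rmorph_mmap; apply: mmap_ext => [x|i] /=.
    by rewrite /horner_eval hornerC.
  by rewrite /horner_eval hornerM hornerX hornerC.
have [sP|sP] := leqP (size Pt) 1.
  pose u := mmap idfun (fun _ : 'I_n => 0) P.
  have Pu : P = u%:MP.
    have e1 : Pt.[1] = P.
      by rewrite ev -[RHS]mmap_mpolyC_id; apply: mmap_eq => i; rewrite mul1r.
    have e0 : Pt.[0] = u%:MP.
      rewrite ev (rmorph_mmap _ (@mpolyC n R)); apply: mmap_ext => // i.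
      by rewrite mul0r /= rmorph0.
    by rewrite -e0 -e1 (size1_polyC sP) !hornerC.
  exists u => //; apply/negPn/negP => /nonunit_maximal [m mx um].
  by have := jacobian_notin_maximal (fun _ => 0) mx (fq m mx); rewrite -/P um.
pose tf : {rmorphism A -> {fraction A}} := @tofrac A.
have tinj : injective tf by exact: tofrac_inj.
have [|L [kappa [t ht]]] := @root_extension _ (map_poly tf Pt).
  by rewrite size_map_inj_poly ?rmorph0.
pose iota : {rmorphism A -> L} := kappa \o tf.
have iinj : injective iota by move=> x y /= e; apply: tinj; apply: fmorph_inj e.
have [p pp [phi [Phi [pl hphi dom]]]] :=
  fg_place (fg_mpoly n fgR) (pchar_mpoly0 n chR) [:: t] iinj.
have [t' ht'] : exists t', Phi t t' by apply: dom; rewrite inE.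
have rt' : (map_poly phi Pt).[t'] = 0.
  apply: (place0_eq pl); rewrite -ht; apply: (polyrel_horner pl _ ht') => i.
  by rewrite !coef_map; apply: hphi.
pose phi0 : {rmorphism R -> 'F_p} := phi \o @mpolyC n R.
pose a i : R := ((t' * phi 'X_i)%R : nat)%:R.
have [m mx mE] := prime_kernel phi0 pp.
have := jacobian_notin_maximal a mx (fq m mx); rewrite mE prime_poly_map => /eqP; case.
rewrite -rt' -/P -[RHS]/(horner_eval t' (map_poly phi Pt)) !rmorph_mmap.
apply: mmap_ext => [x|i]; rewrite /= /horner_eval.
  by rewrite map_polyC hornerC.
transitivity (t' * phi 'X_i); first exact: (Fp_natr phi0).
rewrite rmorphM /= map_polyX map_polyC.
by rewrite hornerM hornerX hornerC.
Qed.

End FromSurjective.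

End Implications.

(** A maximal ideal m with finite residue ring contains a positive integer, which
    would be a unit if R contained a subfield. *)
Lemma affine_fg_ring (R : idomainType) :
  affine_domain R -> [pchar R] =i pred0 -> finite_quotients R -> fg_ring R.
Proof.
move=> [//|[K [[[K1 KB _] Kinv] _]]] ch fq.
have [|m mx _] := @nonunit_maximal R 0; first by rewrite unitr0.
have [k k_gt0 km] := nat_in_ideal (fq m mx).
have Kk : k%:R \in K.
  have K0 : 0 \in K by rewrite -(subrr 1) KB.
  elim: (k) => // j IH.
  have -> : j.+1%:R = j%:R - (0 - 1) :> R by rewrite sub0r opprK natr1.
  by apply: (KB) => //; apply: KB.
have [|kU _] := Kinv _ Kk; first by rewrite (pcharf0P R).1 // -lt0n.
by have := idealr1 m; rewrite -(mulVr kU) idealMr.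
Qed.

Theorem corollary2p4 (R : idomainType) (n : nat) (f : n.-tuple {mpoly R[n]}) :
  affine_domain R ->
  [pchar R] =i pred0 ->
  finite_quotients R ->
  (0 < n)%N ->
  ((forall b : n.-tuple R, exists a : n.-tuple R, poly_map idfun f a = b)
   <-> invertible_map f)
  /\
  (invertible_map f
   <-> (exists2 u : R, u \is a GRing.unit & \det (jacobian f) = u%:MP) /\
       (forall m : idealr R, maximal_ideal m ->
          bijective
            (poly_map (\pi_({ideal_quot m})%qT : {rmorphism R -> {ideal_quot m}})
                      f))).
Proof.
move=> affR ch fq _; have fg := affine_fg_ring affR ch fq.
have i_iii : (forall b : n.-tuple R, exists a : n.-tuple R, poly_map idfun f a = b) ->
    (exists2 u : R, u \is a GRing.unit & \det (jacobian f) = u%:MP) /\ maximal_bijective f.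
  move=> surj; split; first exact: jacobian_unit.
  by move=> m mx; apply: quot_bijective => //; apply: fq.
have iii_ii : (exists2 u : R, u \is a GRing.unit & \det (jacobian f) = u%:MP) /\
    maximal_bijective f -> invertible_map f.
  move=> [[u uu det_f] bij]; apply: (invertible_of_bijective_primes fg ch uu det_f).
    exact: prime_injective_of_maximal.
  exact: prime_surjective_of_maximal.
split; split.
- by move=> /i_iii /iii_ii.
- exact: surjective_of_invertible.
- by move=> /(surjective_of_invertible fg ch) /i_iii.
- exact: iii_ii.
Qed.
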